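(* Let $h:\mathbb{R}_+^n\to\mathbb{R}$ be a continuous payoff function such that $$|A|_{\mathbf{z},\mathbf{d},0,0}(h)<\infty$$ for all multi-indices $\mathbf{z},\mathbf{d}\in\{0,1\}^n$ with $|\mathbf{z}+\mathbf{d}|=n$ and $\|\mathbf{z}+\mathbf{d}\|=1$. Then the price $V^h=B_T^{-1}\mathbb{E}[h(\overline{X}_T)]$ of the European option with payoff $h(\overline{X}_T)$ is given by $$V^h=B_T^{-1}\sum_{\substack{|\mathbf{z}+\mathbf{d}|=n\\ \|\mathbf{z}+\mathbf{d}\|=1}}A_{\mathbf{z},\mathbf{d},0,0}(h).$$
   Context: Setting. $\mathbb{Q}$ is a probability measure (the pricing measure), $\mathbb{E}$ is expectation under $\mathbb{Q}$, $T>0$ is a fixed maturity, and $\overline{X}_T=(X_T^1,\ldots,X_T^n)$ is a random vector with $X_T^k\in L^1(\mathbb{Q})$ and $X_T^k\ge 0$ almost surely for every $k$. The bond $B_t$ is a deterministic non-decreasing function with $B_0=1$. Here $\mathbb{R}_+=[0,\infty)$. Multi-indices $\mathbf{a}\in\{0,1\}^n$ are identified with subsets of $\{1,\ldots,n\}$; $|\mathbf{a}|=a_1+\cdots+a_n$, $\|\mathbf{a}\|=\max_i a_i$. The condition $|\mathbf{z}+\mathbf{d}|=n$, $\|\mathbf{z}+\mathbf{d}\|=1$ means that $\mathbf{d}$ is the complement of $\mathbf{z}$. The operator $\mathbf{0}^{\mathbf{z}}$ sets the variables $x_k$, $k\in\mathbf{z}$, equal to $0$, and $\partial^{\mathbf{d}}=\prod_{k\in\mathbf{d}}\partial_k$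 is taken in the sense of distributions: $\mathbf{0}^{\mathbf{z}}\partial^{\mathbf{d}}h$ denotes the distributional mixed derivative, in the variables $(y_k)_{k\in\mathbf{d}}\in(0,\infty)^{|\mathbf{d}|}$, of the continuous function obtained from $h$ by setting $y_k=0$ for $k\in\mathbf{z}$. The hypothesis $|A|_{\mathbf{z},\mathbf{d},0,0}(h)<\infty$ means that $\mathbf{0}^{\mathbf{z}}\partial^{\mathbf{d}}h$ is a (locally finite) signed Radon measure on $(0,\infty)^{|\mathbf{d}|}$, with total variation $|\mathbf{0}^{\mathbf{z}}\partial^{\mathbf{d}}h|$, and that $$|A|_{\mathbf{z},\mathbf{d},0,0}(h)=\int_{\mathbb{R}_+^{n-|\mathbf{z}|}}\mathbb{Q}\Big(\bigwedge_{\sigma\in\mathbf{d}}(X_T^\sigma>y_\sigma)\Big)\,|\mathbf{0}^{\mathbf{z}}\partial^{\mathbf{d}}h|(d\overline{y})<\infty ;$$ in this case $$A_{\mathbf{z},\mathbf{d},0,0}(h)=\int_{\mathbb{R}_+^{n-|\mathbf{z}|}}\mathbb{Q}\Big(\bigwedge_{\sigma\in\mathbf{d}}(X_T^\sigma>y_\sigma)\Big)\,\mathbf{0}^{\mathbf{z}}\partial^{\mathbf{d}}h(d\overline{y}).$$ For $\mathbf{d}=0$, $A_{\mathbf{z},0,0,0}(h)=h(0,\ldots,0)$. *)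

(* Defs.v *)
From HB Require Import structures.
From mathcomp Require Import all_boot all_order all_algebra.
From mathcomp Require Import all_classical all_reals all_analysis.

Set Implicit Arguments.
Unset Strict Implicit.
Unset Printing Implicit Defensive.

Import Order.TTheory GRing.Theory Num.Theory.
Import numFieldNormedType.Exports.

Local Open Scope classical_set_scope.
Local Open Scope ring_scope.

(* A multi-index a in {0,1}^n is the subset of 'I_n of the k with a_k = 1. *)
Definition madd n (z d : {set 'I_n}) (k : 'I_n) : nat :=
  ((k \in z) + (k \in d))%N.

(* |z + d| = n and ||z + d|| = 1. *)
Definition complementary n (z d : {set 'I_n}) : bool :=
  ((\sum_k madd z d k)%N == n) && ((\max_k madd z d k)%N == 1%N).

Section Orthants.
Context (R : realType).

Definition nonneg_orthant m : set 'rV[R]_m := [set x | forall k, 0 <= x 0 k].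

Definition pos_orthant m : set 'rV[R]_m := [set x | forall k, 0 < x 0 k].

(* The variables (y_k), k in d, are listed in the order of [enum_val]: the
   variable of k = enum_val i is the i-th coordinate of y. *)
Definition face n (z d : {set 'I_n}) (y : 'rV[R]_#|d|) : 'rV[R]_n :=
  \row_k (if k \in z then 0 else \sum_(i < #|d| | enum_val i == k) y 0 i).

End Orthants.

Section Distributions.
Context (R : realType).

Definition partial m (k : 'I_m) (f : 'rV[R]_m -> R) : 'rV[R]_m -> R :=
  'D_(delta_mx 0 k) f.

Definition partials m (s : seq 'I_m) (f : 'rV[R]_m -> R) : 'rV[R]_m -> R :=
  foldr (@partial m) f s.

Definition smooth m (f : 'rV[R]_m -> R) : Prop :=
  forall s : seq 'I_m, continuous (partials s f) /\
    forall (k : 'I_m) (x : 'rV[R]_m),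
      derivable (partials s f) x (delta_mx 0 k).

(* Test functions on the open set (0,oo)^m, extended by 0 to R^m. *)
Definition test_function m (phi : 'rV[R]_m -> R) : Prop :=
  [/\ smooth phi,
      compact (closure [set y | phi y != 0]) &
      closure [set y | phi y != 0] `<=` @pos_orthant R m].

(* Integral over R^m against Lebesgue measure, as an iterated integral; it is
   only applied to continuous functions with compact support, for which the
   two coincide by Fubini's theorem. *)
Fixpoint lebesgue_rV m : ('rV[R]_m -> R) -> R :=
  match m with
  | 0%N => fun f => f 0
  | m'.+1 => fun f =>
      \int[@lebesgue_measure R]_x
        lebesgue_rV (fun y : 'rV[R]_m' => f (row_mx (x%:M : 'rV[R]_1) y))
  end.

Definition borel_rV m := g_sigma_algebraType (@open 'rV[R]_m).

(* A signed Radon measure on (0,oo)^m. As it may have infinite mass of both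
   signs, it need not be a [charge] and is given by its Jordan decomposition,
   two mutually singular locally finite Borel measures; these are seen as
   measures on R^m carried by (0,oo)^m. *)
Record signed_radon m := SignedRadon {
  radon_pos : {measure set (borel_rV m) -> \bar R} ;
  radon_neg : {measure set (borel_rV m) -> \bar R} ;
  radon_carrier : radon_pos (~` @pos_orthant R m) = 0%E /\
                  radon_neg (~` @pos_orthant R m) = 0%E ;
  radon_locally_finite : forall K : set 'rV[R]_m,
    compact K -> K `<=` @pos_orthant R m ->
    (radon_pos K < +oo)%E /\ (radon_neg K < +oo)%E ;
  radon_singular : exists S : set (borel_rV m),
    [/\ measurable S, radon_pos (~` S) = 0%E & radon_neg S = 0%E] }.

Definition radon_variation m (mu : signed_radon m) :
    {measure set (borel_rV m) -> \bar R} :=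
  measure_add (radon_pos mu) (radon_neg mu).

(* mu is the distributional derivative 0^z d^d h on (0,oo)^|d|. *)
Definition is_mixed_derivative n (h : 'rV[R]_n -> R) (z d : {set 'I_n})
    (mu : signed_radon #|d|) : Prop :=
  forall phi : 'rV[R]_#|d| -> R, test_function phi ->
    (\int[radon_pos mu]_y phi y) - (\int[radon_neg mu]_y phi y) =
    (-1) ^+ #|d| *
      lebesgue_rV (fun y => h (face z y) * partials (enum 'I_#|d|) phi y).

End Distributions.

Section Pricing.
Local Open Scope ereal_scope.
Context (R : realType) (disp : measure_display) (Omega : measurableType disp)
  (Q : probability Omega R) (n : nat).
Implicit Types (X : 'I_n -> {RV Q >-> R}) (h : 'rV[R]_n -> R).
Implicit Types (z d : {set 'I_n}).

Definition price (B : R -> R) (T : R) X h : \bar R :=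
  ((B T)^-1)%:E * 'E_Q[fun w => h (\row_k X k w)].

(* Q (X_T^s > y_s for all s in d) *)
Definition joint_tail X d (y : 'rV[R]_#|d|) : \bar R :=
  Q [set w | forall i : 'I_#|d|, (y ord0 i < X (enum_val i) w)%R].

(* |A|_{z,d,0,0}(h), set to +oo when 0^z d^d h is not a signed Radon measure.
   A distribution is represented by at most one such measure, so the choice
   made by [cid] is immaterial. *)
Definition absA X h z d : \bar R :=
  if d == finset.set0 then `|h 0|%:E
  else match pselect (exists mu, @is_mixed_derivative R n h z d mu) with
       | left ex_mu =>
           \int[radon_variation (sval (cid ex_mu))]_(y in @pos_orthant R #|d|)
             joint_tail X y
       | right _ => +oo
       end.

(* A_{z,d,0,0}(h); only meaningful when absA X h z d < +oo. *)
Definition valA X h z d : \bar R :=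
  if d == finset.set0 then (h 0)%:E
  else match pselect (exists mu, @is_mixed_derivative R n h z d mu) with
       | left ex_mu =>
           \int[radon_pos (sval (cid ex_mu))]_(y in @pos_orthant R #|d|)
             joint_tail X y -
           \int[radon_neg (sval (cid ex_mu))]_(y in @pos_orthant R #|d|)
             joint_tail X y
       | right _ => 0
       end.

End Pricing.

(* Main.v *)
(* Expand h by inclusion-exclusion over the faces of the orthant: h(x) is the
   sum over d of Delta_d h(x), the increment over the box (0, x) of the
   restriction of h to the face of d. When 0^z d^d h is a measure mu, Delta_d h(x)
   is mu((0, x)): test mu against products of smooth approximations of the
   indicators of the (0, x_i); on the measure side dominated convergence applies
   as soon as mu((0, x)) is finite, and on the other side the derivatives of these
   approximations tend to differences of Dirac masses at 0 and x_i, which pick out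
   the corner values of h. By Tonelli, the integral of Q(X > y) against |mu| is the
   expectation of |mu|((0, X)), so the hypothesis makes |mu|((0, X)) almost surely
   finite, and Fubini gives E[Delta_d h(X)] = A_{z,d}(h). *)

Require Import Defs.
From HB Require Import structures.
From mathcomp Require Import all_boot all_order all_algebra.
From mathcomp Require Import all_classical all_reals all_analysis.
From mathcomp Require Import measurable_realfun ring lra.
Set Implicit Arguments.
Unset Strict Implicit.
Unset Printing Implicit Defensive.
Import Order.TTheory GRing.Theory Num.Theory.
Import numFieldNormedType.Exports.
Local Open Scope classical_set_scope.
Local Open Scope ring_scope.

(** The measure [mu] is locally finite only inside the open orthant, so its mass may blow up at the
    faces, and a box touching them may have infinite mass of both signs. The identity between
    increments and box masses is thus available only where these masses are finite. Prices may also
    vanish: the box is then empty, and the increment has to be shown to be zero separately. The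
    payoff is continuous on the closed orthant only and arbitrary elsewhere, whereas the limits are
    taken in the whole space. Composing with the retraction [clamp] gives a globally continuous
    function, which changes nothing against test functions whose mixed derivatives vanish off the
    orthant. The test functions are products of differences of two smooth ramps. The derivative of a
    ramp is a probability density on an interval of length 1/L, so expanding the product leaves one
    product density per vertex of the box, and no regularity beyond continuity is asked of the
    payoff. Since [lebesgue_rV] is an iterated integral, each use of linearity needs the inner
    integrals to be integrable; continuity and a common compact support provide this. *)

Section RowVectors.
Context (R : realType).

Lemma continuous_rV (T : topologicalType) m (F : T -> 'rV[R]_m) :
  (forall i, continuous (fun t => F t 0 i)) -> continuous F.
Proof.
move=> cF t; apply/cvg_ballP => e e0.
have : \forall u \near t, forall i, ball (F t 0 i) e (F u 0 i).
  by apply: filter_forall => i; have /cvg_ballP/(_ _ e0) := cF i t.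
by apply: filterS => u Fu; split => // i j; rewrite [i]ord1.
Qed.

Lemma continuous_row_mxr m (x : R) :
  continuous (fun y : 'rV[R]_m => row_mx (x%:M : 'rV[R]_1) y).
Proof.
apply: continuous_rV => i.
case: (split_ordP (i : 'I_(1 + m))) => [j ->|j ->].
  under eq_fun do rewrite row_mxEl; exact: cst_continuous.
under eq_fun do rewrite row_mxEr; exact: coord_continuous.
Qed.

(** Only [x] is confined to the compact cube; [y] may lie outside. Hence the covering argument is
    run on the property that [f] varies by less than [e] on a full ball around [x]. *)
Lemma uniformly_continuous_box m (f : 'rV[R]_m -> R) (M e : R) :
  continuous f -> 0 < e ->
  exists2 d, 0 < d & forall x y : 'rV[R]_m, (forall i, `|x 0 i| <= M) ->
    (forall i, `|x 0 i - y 0 i| < d) -> `|f x - f y| < e.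
Proof.
move=> cf e0.
have cK : compact [set v : 'rV[R]_m | forall i, v ord0 i \in `[(- M), M]].
  apply: (@rV_compact _ _ (fun=> `[(- M), M]%classic)) => _.
  exact: segment_compact.
have /compact_near_coveringP/(_ R (0 : R)^'+
  (fun d x => forall y : 'rV[R]_m, ball x d y -> `|f x - f y| < e) _) : compact _ := cK.
have H : forall x : 'rV[R]_m, [set v : 'rV[R]_m | forall i, v ord0 i \in `[(- M), M]] x ->
    \forall x' \near x & d \near (0 : R)^'+,
      forall y : 'rV[R]_m, ball x' d y -> `|f x' - f y| < e.
  move=> x _.
  have /cvgrPdist_lt/(_ (e / 2)) := cf x.
  rewrite divr_gt0// => /(_ isT) /nbhs_ballP[d d0 fd].
  exists (ball x (d / 2), [set t | t < d / 2]); first split.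
  - by apply: nbhsx_ballx; rewrite divr_gt0.
  - by apply: nbhs_right_lt; rewrite divr_gt0.
  move=> [x' d'] /= [xx' dd'] y x'y.
  rewrite /= in d0.
  have fx' : `|f x - f x'| < e / 2 by apply: fd; apply: le_ball xx'; lra.
  have fy : `|f x - f y| < e / 2.
    apply: fd; rewrite (splitr d); apply: ball_triangle xx' _.
    by apply: le_ball x'y; exact: ltW.
  rewrite (splitr e) -[f x'](subrK (f x)) -addrA (le_lt_trans (ler_normD _ _))//.
  by rewrite ltrD// distrC.
move=> /(_ H) HH.
near (0 : R)^'+ => d.
have d0 : 0 < d by near: d; exact: nbhs_right_gt.
exists d => // x y xM xy.
have : [set v : 'rV[R]_m | forall i, v ord0 i \in `[(- M), M]] `<=`
    [set x : 'rV[R]_m | forall y : 'rV[R]_m, ball x d y -> `|f x - f y| < e].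
  by near: d.
apply.
- by move=> i /=; rewrite in_itv/= -ler_norml.
- by split=> // i j; rewrite [i]ord1; exact: xy.
Unshelve. all: by end_near. Qed.

End RowVectors.

(** * The iterated Lebesgue integral *)

Section IteratedIntegral.
Context (R : realType).
Implicit Types (m : nat) (M : R).

(** The radius [M] stays explicit because slices inherit the same one, and because it enters the
    bound by the volume of the cube. *)
Definition supported_in m M (f : 'rV[R]_m -> R) : Prop :=
  continuous f /\ forall (y : 'rV[R]_m) i, M < `|y 0 i| -> f y = 0.

Lemma integrable_supported M (u : R -> R) : continuous u ->
  (forall x, M < `|x| -> u x = 0) ->
  (@lebesgue_measure R).-integrable setT (EFin \o u).
Proof.
move=> cu u0.
have -> : EFin \o u = (EFin \o u) \_ `[- M, M].
  apply/funext => x; rewrite patchE; case: ifPn => //.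
  rewrite notin_setE/= in_itv/= -ler_norml => /negP; rewrite -ltNge => /u0 ux.
  by rewrite ux.
rewrite -integrable_mkcond//; apply: continuous_compact_integrable.
  exact: segment_compact.
exact: continuous_subspaceT.
Qed.

Lemma le_norm_Rintegral_supported M (D : R) (u : R -> R) : continuous u -> 0 <= M ->
  (forall x, M < `|x| -> u x = 0) -> (forall x, `|u x| <= D) ->
  `|\int[@lebesgue_measure R]_x u x| <= D * (2 * M).
Proof.
move=> cu M0 u0 uD.
have iu : (@lebesgue_measure R).-integrable setT (EFin \o u).
  exact: integrable_supported u0.
have -> : \int[@lebesgue_measure R]_x u x =
    \int[@lebesgue_measure R]_(x in `[- M, M]) u x.
  rewrite [RHS]Rintegral_mkcond; congr (Rintegral _ _ _); apply/funext => x.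
  rewrite patchE; case: ifPn => //.
  by rewrite notin_setE/= in_itv/= -ler_norml => /negP; rewrite -ltNge => /u0.
have iu' : (@lebesgue_measure R).-integrable `[- M, M] (EFin \o u).
  exact: integrableS iu.
apply: le_trans (le_normr_Rintegral _ iu') _ => //.
apply: (@le_trans _ _ (\int[@lebesgue_measure R]_(x in `[- M, M]) D)).
  apply: le_Rintegral => //.
    exact: integrable_norm.
  apply/integrableP; split; first exact: measurable_cst.
  rewrite integral_cst//= lebesgue_measure_itv/= lte_fin.
  by case: ifP => _; rewrite ?mule0 ?ltry// -EFinD -EFinM ltry.
rewrite Rintegral_cst; last exact: measurable_itv.
rewrite /= lebesgue_measure_itv/= lte_fin.
case: ifPn => [_|]; first by rewrite /= opprK mulr2n mulrDl !mul1r.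
by rewrite -leNgt => MM; rewrite /= mulr0 mulr_ge0 ?(le_trans _ (uD 0)) ?mulr_ge0.
Qed.

Lemma supported_in_slice m M (f : 'rV[R]_m.+1 -> R) x : supported_in M f ->
  supported_in M (fun y : 'rV[R]_m => f (row_mx (x%:M : 'rV[R]_1) y)).
Proof.
move=> [cf f0]; split=> [y|y i My].
  apply: (continuous_comp (f := fun y : 'rV[R]_m => row_mx (x%:M : 'rV[R]_1) y)).
    exact: continuous_row_mxr.
  exact: cf.
by apply: (f0 _ (rshift 1 i)); rewrite (@row_mxEr _ _ 1).
Qed.

Lemma supported_in_slice0 m M (f : 'rV[R]_m.+1 -> R) x (y : 'rV[R]_m) :
  supported_in M f -> M < `|x| -> f (row_mx (x%:M : 'rV[R]_1) y) = 0.
Proof.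
move=> [cf f0] Mx.
by apply: (f0 _ (lshift m (0 : 'I_1))); rewrite (@row_mxEl _ _ 1) mxE eqxx mulr1n.
Qed.

Lemma supported_in_lin m M c (f g : 'rV[R]_m -> R) :
  supported_in M f -> supported_in M g ->
  supported_in M (fun y => c * f y + g y).
Proof.
move=> [cf f0] [cg g0]; split=> [y|y i My]; last first.
  by rewrite (f0 _ _ My) (g0 _ _ My) mulr0 addr0.
exact: cvgD (cvgM (cvg_cst _) (cf y)) (cg y).
Qed.

Lemma lebesgue_rV0 m : lebesgue_rV (fun _ : 'rV[R]_m => 0) = 0.
Proof.
elim: m => //= m IH; under eq_Rintegral do rewrite IH.
by rewrite Rintegral_cst// mul0r.
Qed.

(** Linearity and the bound go through the induction on the dimension together. In dimension [m]
    they show that the slice integral depends continuously on the first coordinate: a difference of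
    slice integrals is one integral, small by the bound. Continuity makes it integrable, which
    yields both properties in dimension [m.+1]. *)
Let lin m := forall M, 0 <= M -> forall c (f g : 'rV[R]_m -> R),
  supported_in M f -> supported_in M g ->
  lebesgue_rV (fun y => c * f y + g y) = c * lebesgue_rV f + lebesgue_rV g.

Let bnd m := forall M, 0 <= M -> forall (D : R) (f : 'rV[R]_m -> R),
  supported_in M f -> (forall y, `|f y| <= D) ->
  `|lebesgue_rV f| <= D * (2 * M) ^+ m.

Let continuous_slice m M (f : 'rV[R]_m.+1 -> R) : lin m -> bnd m ->
  0 <= M -> supported_in M f -> continuous (fun x =>
    lebesgue_rV (fun y : 'rV[R]_m => f (row_mx (x%:M : 'rV[R]_1) y))).
Proof.
move=> linm bndm M0 sf x; apply/cvgrPdist_lt => e e0.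
pose C := (2 * M) ^+ m.
have C0 : 0 <= C by rewrite exprn_ge0// mulr_ge0.
have e'0 : 0 < e / (C + 1) by rewrite divr_gt0// ltr_wpDl.
have [d d0 fd] := uniformly_continuous_box (Num.max M `|x|) sf.1 e'0.
near=> x'.
have -> : forall a b : R, a - b = -1 * b + a by move=> a b; rewrite mulN1r addrC.
rewrite -(linm M)//; [|exact: supported_in_slice..].
apply: (@le_lt_trans _ _ (e / (C + 1) * C)); last first.
  by rewrite mulrAC ltr_pdivrMr ?ltr_wpDl// ltr_pM2l// ltrDl.
apply: bndm => // [|y].
  by apply: supported_in_lin; exact: supported_in_slice.
case: (pselect (exists i, M < `|y 0 i|)) => [[i Mi]|nM].
  rewrite !((supported_in_slice _ sf).2 _ _ Mi) mulr0 addr0 normr0.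
  exact: ltW.
rewrite mulN1r addrC ltW// fd// => i.
  case: (split_ordP (i : 'I_(1 + m))) => [j ->|j ->].
    by rewrite (@row_mxEl _ _ 1) mxE [j]ord1 eqxx mulr1n le_max lexx orbT.
  rewrite (@row_mxEr _ _ 1) le_max leNgt; apply/orP; left; apply/negP => Mj.
  by apply: nM; exists j.
case: (split_ordP (i : 'I_(1 + m))) => [j ->|j ->].
  rewrite !(@row_mxEl _ _ 1) !mxE [j]ord1 eqxx !mulr1n.
  by near: x'; apply: cvgr_dist_lt.
by rewrite !(@row_mxEr _ _ 1) subrr normr0.
Unshelve. all: by end_near. Qed.

Let lin_bnd m : lin m /\ bnd m.
Proof.
elim: m => [|m [linm bndm]]; first split.
- by [].
- by move=> M M0 D f _ fD; rewrite expr0 mulr1; exact: fD.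
have cs := continuous_slice linm bndm.
have s0 M (f : 'rV[R]_m.+1 -> R) x : supported_in M f -> M < `|x| ->
    lebesgue_rV (fun y : 'rV[R]_m => f (row_mx (x%:M : 'rV[R]_1) y)) = 0.
  move=> sf Mx; rewrite -[RHS](lebesgue_rV0 m); congr lebesgue_rV.
  by apply/funext => y; rewrite (supported_in_slice0 y sf Mx).
split=> M M0.
  move=> c f g sf sg /=.
  under eq_Rintegral => x _.
    rewrite (linm M)//; [|exact: supported_in_slice..]; over.
  have If := integrable_supported (cs _ _ M0 sf) (fun x => @s0 _ _ x sf).
  have Ig := integrable_supported (cs _ _ M0 sg) (fun x => @s0 _ _ x sg).
  rewrite RintegralD//; first by rewrite RintegralZl.
  by have := integrableZl measurableT c If; under eq_fun do rewrite -EFinM.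
move=> D f sf fD /=.
rewrite exprS mulrCA [_ * (D * _)]mulrC.
apply: le_norm_Rintegral_supported => // [|x Mx|x].
- exact: cs sf.
- exact: s0 Mx.
- by apply: bndm => //; exact: supported_in_slice.
Qed.

Lemma lebesgue_rV_linear m M c (f g : 'rV[R]_m -> R) : 0 <= M ->
  supported_in M f -> supported_in M g ->
  lebesgue_rV (fun y => c * f y + g y) = c * lebesgue_rV f + lebesgue_rV g.
Proof. by move=> M0; exact: (lin_bnd m).1. Qed.

Lemma lebesgue_rV_sum m M (I : Type) (r : seq I) (f : I -> 'rV[R]_m -> R) :
  0 <= M -> (forall i, supported_in M (f i)) ->
  lebesgue_rV (fun y => \sum_(i <- r) f i y) = \sum_(i <- r) lebesgue_rV (f i).
Proof.
move=> M0 sf.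
suff [_ //] : supported_in M (fun y => \sum_(i <- r) f i y) /\
  lebesgue_rV (fun y => \sum_(i <- r) f i y) = \sum_(i <- r) lebesgue_rV (f i).
elim: r => [|i r [s IH]].
  rewrite big_nil; under eq_fun do rewrite big_nil.
  split; last exact: lebesgue_rV0.
  by split=> //; exact: cst_continuous.
rewrite big_cons; under eq_fun do rewrite big_cons -[X in X + _]mul1r.
by split; [exact: supported_in_lin|rewrite (lebesgue_rV_linear _ M0)// mul1r IH].
Qed.

Lemma lebesgue_rV_ge0 m (f : 'rV[R]_m -> R) : (forall y, 0 <= f y) ->
  0 <= lebesgue_rV f.
Proof.
elim: m f => [|m IH] f f0 /=; first exact: f0.
by apply: Rintegral_ge0 => x _; exact: IH.
Qed.

End IteratedIntegral.

(** * Products of one-variable weights *)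

Section ProductWeights.
Context (R : realType).
Implicit Types (m : nat) (M : R).

Lemma continuous_prod_coord m (w : 'I_m -> R -> R) :
  (forall i, continuous (w i)) ->
  continuous (fun y : 'rV[R]_m => \prod_i w i (y 0 i)).
Proof.
move=> cw; apply: continuous_big => [|i _ y].
  by move=> [a b]; apply: cvgM; [exact: cvg_fst|exact: cvg_snd].
apply: (continuous_comp (f := fun y : 'rV[R]_m => y 0 i)).
  exact: coord_continuous.
exact: cw.
Qed.

Lemma supported_in_prod m M (w : 'I_m -> R -> R) (g : 'rV[R]_m -> R) :
  (forall i, continuous (w i)) -> (forall i x, M < `|x| -> w i x = 0) ->
  continuous g -> supported_in M (fun y => g y * \prod_i w i (y 0 i)).
Proof.
move=> cw w0 cg; split=> [y|y i My]; last by rewrite (bigD1 i)//= w0// mul0r mulr0.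
exact: cvgM (cg y) (@continuous_prod_coord _ _ cw y).
Qed.

Lemma supported_in_prod1 m M (w : 'I_m -> R -> R) :
  (forall i, continuous (w i)) -> (forall i x, M < `|x| -> w i x = 0) ->
  supported_in M (fun y : 'rV[R]_m => \prod_i w i (y 0 i)).
Proof.
move=> cw w0.
have -> : (fun y : 'rV[R]_m => \prod_i w i (y 0 i)) =
    (fun y => cst 1 y * \prod_i w i (y 0 i)) by apply/funext => y; rewrite mul1r.
by apply: supported_in_prod => //; exact: cst_continuous.
Qed.

Lemma lebesgue_rV_prod m M (w : 'I_m -> R -> R) : 0 <= M ->
  (forall i, continuous (w i)) -> (forall i x, M < `|x| -> w i x = 0) ->
  lebesgue_rV (fun y : 'rV[R]_m => \prod_i w i (y 0 i)) =
  \prod_i \int[@lebesgue_measure R]_x w i x.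
Proof.
move=> M0; elim: m w => [|m IH] w cw w0; first by rewrite /= !big_ord0.
have e0 : (ord0 : 'I_m.+1) = lshift m (0 : 'I_1) by apply/val_inj.
have e1 (i : 'I_m) : lift ord0 i = rshift 1 i by apply/val_inj.
transitivity (\int[@lebesgue_measure R]_x
    (w ord0 x * lebesgue_rV (fun y : 'rV[R]_m => \prod_i w (lift ord0 i) (y 0 i)))).
  rewrite /=; apply: eq_Rintegral => x _.
  have s : supported_in M (fun y : 'rV[R]_m => \prod_i w (lift ord0 i) (y 0 i)).
    exact: (@supported_in_prod1 m M (fun i => w (lift ord0 i))
      (fun i => cw _) (fun i => @w0 _)).
  have s0 : supported_in M (fun _ : 'rV[R]_m => 0).
    by split=> //; exact: cst_continuous.
  rewrite -[RHS]addr0 -[X in _ + X](lebesgue_rV0 R m) -(lebesgue_rV_linear _ M0 s s0).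
  congr lebesgue_rV; apply/funext => y.
  rewrite addr0 big_ord_recl; congr (w _ _ * _).
    by rewrite e0 (@row_mxEl _ _ 1) mxE eqxx mulr1n.
  by apply: eq_bigr => i _; congr (w _ _); rewrite e1 (@row_mxEr _ _ 1).
rewrite RintegralZr//; last exact: integrable_supported (cw _) (@w0 _).
by rewrite big_ord_recl (IH (fun i => w (lift ord0 i)) (fun i => cw _) (fun i => @w0 _)).
Qed.

(** The product of the weights is a probability density, so this bounds the error of an average of
    [g]. Both inequalities come from positivity of the integral, applied to [e] times the density
    plus or minus the deviation. *)
Lemma dist_lebesgue_rV_prod m M (w : 'I_m -> R -> R) (g : 'rV[R]_m -> R) p (e : R) :
  0 <= M ->
  (forall i, continuous (w i)) -> (forall i x, M < `|x| -> w i x = 0) ->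
  (forall i x, 0 <= w i x) -> (forall i, \int[@lebesgue_measure R]_x w i x = 1) ->
  continuous g ->
  (forall y : 'rV[R]_m, (forall i, w i (y 0 i) != 0) -> `|g y - g p| <= e) ->
  `|lebesgue_rV (fun y => g y * \prod_i w i (y 0 i)) - g p| <= e.
Proof.
move=> M0 cw w0 w_ge0 w1 cg gp.
have s1 : supported_in M (fun y : 'rV[R]_m => \prod_i w i (y 0 i)).
  exact: supported_in_prod1.
have sg := supported_in_prod cw w0 cg.
have L1 : lebesgue_rV (fun y : 'rV[R]_m => \prod_i w i (y 0 i)) = 1.
  by rewrite (lebesgue_rV_prod M0)// big1.
have key (y : 'rV[R]_m) : `|g y * \prod_i w i (y 0 i) - g p * \prod_i w i (y 0 i)| <=
    e * \prod_i w i (y 0 i).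
  rewrite -mulrBl normrM [X in _ * X <= _]ger0_norm; last exact: prodr_ge0.
  case: (pselect (forall i, w i (y 0 i) != 0)) => [wy|].
    by rewrite ler_wpM2r// ?gp//; exact: prodr_ge0.
  move=> /existsNP[i /negP]; rewrite negbK => /eqP wi.
  by rewrite (bigD1 i)//= wi mul0r !mulr0.
rewrite ler_distl; apply/andP; split.
  have : 0 <= lebesgue_rV (fun y : 'rV[R]_m => (e - g p) * \prod_i w i (y 0 i) +
      g y * \prod_i w i (y 0 i)).
    apply: lebesgue_rV_ge0 => y; have := key y; rewrite ler_distl => /andP[+ _].
    by rewrite mulrBl; lra.
  by rewrite (lebesgue_rV_linear _ M0)// L1; lra.
have : 0 <= lebesgue_rV (fun y : 'rV[R]_m => -1 * (g y * \prod_i w i (y 0 i)) +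
    ((e + g p) * \prod_i w i (y 0 i) + 0)).
  apply: lebesgue_rV_ge0 => y; have := key y; rewrite ler_distl => /andP[_].
  by rewrite mulrDl; lra.
have s0 : supported_in M (fun _ : 'rV[R]_m => 0).
  by split=> //; exact: cst_continuous.
rewrite (lebesgue_rV_linear _ M0)//; last exact: supported_in_lin.
by rewrite (lebesgue_rV_linear _ M0)// L1 lebesgue_rV0; lra.
Qed.

End ProductWeights.

(** * Smooth test functions *)

Section SmoothStep.
Context (R : realType).
Implicit Types (f g : R -> R).

(** Carrying the derivative as a witness lets the closure properties follow by induction on [n] from
    explicit derivative formulas. *)
Fixpoint class_C (n : nat) f : Prop :=
  if n is n'.+1 then
    exists2 f' : R -> R, (forall x : R, is_derive x 1 f (f' x)) & class_C n' f'
  else continuous f.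

Lemma is_derive_continuous f f' : (forall x : R, is_derive x 1 f (f' x)) ->
  continuous f.
Proof.
move=> df x; apply: differentiable_continuous.
by apply/derivable1_diffP; exact: ex_derive.
Qed.

Lemma class_CS n f : class_C n.+1 f -> class_C n f.
Proof.
elim: n f => [|n IH] f [f' df Cf']; first exact: is_derive_continuous df.
by exists f' => //; exact: IH.
Qed.

Lemma class_C_cst n c : class_C n (cst c).
Proof.
elim: n c => [|n IH] c /=; first exact: cst_continuous.
by exists (cst 0) => // x; exact: is_derive_cst.
Qed.

Lemma class_CD n f g : class_C n f -> class_C n g ->
  class_C n (fun x => f x + g x).
Proof.
elim: n f g => [|n IH] f g /=; first by move=> cf cg x; exact: cvgD (cf x) (cg x).
move=> [f' df Cf'] [g' dg Cg']; exists (fun x => f' x + g' x); last exact: IH.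
by move=> x; exact: is_deriveD.
Qed.

Lemma class_CM n f g : class_C n f -> class_C n g ->
  class_C n (fun x => f x * g x).
Proof.
elim: n f g => [|n IH] f g /=; first by move=> cf cg x; exact: cvgM (cf x) (cg x).
move=> Cf Cg; have [f' df Cf'] := Cf; have [g' dg Cg'] := Cg.
exists (fun x => f x * g' x + g x * f' x).
  by move=> x; exact: is_deriveM.
by apply: class_CD; apply: IH => //; exact: class_CS.
Qed.

Lemma class_CV n f : (forall x, f x != 0) -> class_C n f ->
  class_C n (fun x => (f x)^-1).
Proof.
move=> f0; elim: n => [|n IH] /=.
  by move=> cf x; apply: cvgV; [exact: f0|exact: cf].
move=> Cf; have [f' df Cf'] := Cf.
exists (fun x => (cst (-1) x * ((f x)^-1 * (f x)^-1)) * f' x).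
  move=> x; apply: is_derive_eq (is_deriveV (f0 x) (df x)) _.
  by rewrite /cst -invfM -expr2 mulN1r.
apply: class_CM => //; apply: class_CM; first exact: class_C_cst.
by apply: class_CM; apply: IH; exact: class_CS Cf.
Qed.

Lemma is_derive_affine (a b x : R) : is_derive x 1 (fun t => a * t + b) a.
Proof.
have h : is_derive x 1 (fun t : R => a *: t + b) (a *: 1 + 0).
  by apply: is_deriveD.
by move: h; rewrite addr0 [a *: 1]mulr1.
Qed.

Lemma class_C_affine n f a b : class_C n f -> class_C n (fun t => f (a * t + b)).
Proof.
elim: n f => [|n IH] f /=.
  move=> cf x; apply: (continuous_comp (f := fun t => a * t + b)); last exact: cf.
  exact: (is_derive_continuous (is_derive_affine a b)).
move=> [f' df Cf']; exists (fun x => f' (a * x + b) * cst a x).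
  by move=> x; apply: (is_derive1_comp (df _)); exact: is_derive_affine.
by apply: class_CM; [exact: IH|exact: class_C_cst].
Qed.

Lemma ndecr_is_derive_ge0 f (x d : R) : {homo f : s t / s <= t} ->
  is_derive x 1 f d -> 0 <= d.
Proof.
move=> ndf dfx; rewrite -(derive_val (is_derive := dfx)).
apply: limr_ge; first exact: (ex_derive (is_derive := dfx)).
near=> h; rewrite /= [h *: 1]mulr1 -[_ *: _]/(_ * _).
case: (ltgtP h 0) => [h0|h0|h0].
- by apply: mulr_le0; rewrite ?invr_le0 ?subr_le0 ?ndf ?gerDr// ltW.
- by apply: mulr_ge0; rewrite ?invr_ge0 ?subr_ge0 ?ndf ?lerDr// ltW.
- by rewrite h0 invr0 mul0r.
Unshelve. all: by end_near. Qed.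

(** The whole family in [k] is needed: the derivative of a member is a combination of later members,
    so smoothness is an induction over all [k] at once. *)
Definition flat (k : nat) (x : R) : R := if 0 < x then x^-1 ^+ k * expR (- x^-1) else 0.

Lemma flat_ge0 k x : 0 <= flat k x.
Proof.
rewrite /flat; case: ifP => // x0.
by rewrite mulr_ge0// ?expR_ge0// exprn_ge0// invr_ge0 ltW.
Qed.

(** The exponential of 1/x dominates the term of degree [k.+2] of its series. The two extra degrees
    give a quadratic bound, which forces the derivative at 0 to vanish. *)
Lemma flat_le k x : flat k x <= (k.+2)`!%:R * x ^+ 2.
Proof.
rewrite /flat; case: ifPn => x0; last by rewrite mulr_ge0// sqr_ge0.
have u0 : 0 <= x^-1 by rewrite invr_ge0 ltW.
have := expR_ge1Dxn k.+1 u0; set e := expR _ => H.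
rewrite expRN -/e.
have e0 : 0 < e by exact: expR_gt0.
rewrite ler_pdivrMr//.
have H2 : x^-1 ^+ k.+2 / (k.+2)`!%:R <= e by apply: le_trans H; rewrite lerDr.
rewrite ler_pdivrMr ?ltr0n ?fact_gt0// in H2.
have -> : x^-1 ^+ k = x ^+ 2 * x^-1 ^+ k.+2.
  by rewrite -[k.+2]/(2 + k)%N exprD mulrA -exprMn divff ?gt_eqF// expr1n mul1r.
by rewrite [leRHS]mulrAC mulrC ler_wpM2r ?sqr_ge0// mulrC.
Qed.

Lemma is_derive_flat k (x : R) :
  is_derive x 1 (flat k) (flat k.+2 x + - k%:R * flat k.+1 x).
Proof.
case: (ltgtP x 0) => [x0|x0|->].
- rewrite /flat !ltNge (ltW x0)/= mulr0 addr0.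
  apply: (@near_eq_is_derive _ _ _ (cst (0 : R) : R -> R)).
  near=> y; rewrite ifF//; apply/negbTE; rewrite -leNgt ltW//.
  by near: y; exact: lt_nbhsl.
- apply: (@near_eq_is_derive _ _ _
    ((fun y : R => y^-1 ^+ k) * (fun y : R => expR (- y^-1)))).
    by near=> y; rewrite /flat ifT//; near: y; exact: lt_nbhsr.
  have dV : is_derive x 1 (fun y : R => y^-1) (- x ^- 2).
    have := is_deriveV (f := id) (lt0r_neq0 x0) (is_derive_id x 1).
    by rewrite [_ *: 1]mulr1.
  have dVN : is_derive x 1 (fun y : R => - y^-1) (x ^- 2).
    by have := is_deriveN dV; rewrite opprK.
  have dE := is_derive1_comp (g := fun y : R => - y^-1)
    (is_derive_expR (- x^-1)) dVN.
  have dX := is_deriveX k dV; rewrite exprfctE in dX.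
  apply: is_derive_eq (is_deriveM dX dE) _.
  rewrite /flat x0.
  rewrite /GRing.scale /=.
  rewrite -exprVn; move: (x^-1) (expR _) => u e.
  by case: k {dX} => [|k]; rewrite /= ?exprS; ring.
- rewrite {2 3}/flat ltxx mulr0 addr0.
  suff H : h^-1 *: ((flat k \o shift 0) (h *: 1) - flat k 0) @[h --> (0 : R)^'] --> (0 : R).
    by split; [apply/cvg_ex; exists 0|exact: cvg_lim].
  apply/cvgr0Pnorm_lt => e e0; pose C : R := (k.+2)`!%:R.
  have C0 : 0 < C by rewrite ltr0n fact_gt0.
  near=> h.
  have h0 : h != 0 by near: h; exact: (nbhs_dnbhs_neq (0 : R)).
  rewrite /= addr0 [h *: 1]mulr1 {2}/flat ltxx subr0 normrM normfV.
  rewrite (ger0_norm (flat_ge0 _ _)) mulrC ltr_pdivrMr ?normr_gt0//.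
  apply: le_lt_trans (flat_le _ _) _.
  rewrite -(real_normK (num_real h)) expr2 mulrA ltr_pM2r ?normr_gt0//.
  rewrite -ltr_pdivlMl// mulrC.
  near: h; apply: dnbhs0_lt; rewrite divr_gt0//.
Unshelve. all: by end_near. Qed.

Lemma class_C_flat n k : class_C n (flat k).
Proof.
elim: n k => [|n IH] k /=; first exact: is_derive_continuous (is_derive_flat k).
exists (fun x => flat k.+2 x + cst (- k%:R) x * flat k.+1 x).
  by move=> x; exact: is_derive_flat.
by apply: class_CD; [|apply: class_CM; [exact: class_C_cst|]]; exact: IH.
Qed.

Lemma flat_gt0 x : 0 < x -> 0 < flat 0 x.
Proof. by move=> x0; rewrite /flat x0 expr0 mul1r expR_gt0. Qed.

Lemma flat_eq0 x : x <= 0 -> flat 0 x = 0.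
Proof. by move=> x0; rewrite /flat ltNge x0. Qed.

Lemma flat_ndecr : {homo flat 0 : s t / s <= t}.
Proof.
move=> s t st; case: (ltP 0 s) => s0; last by rewrite flat_eq0// flat_ge0.
have t0 := lt_le_trans s0 st.
by rewrite /flat s0 t0 !expr0 !mul1r ler_expR lerN2 lef_pV2.
Qed.

(** The standard smooth transition from 0 to 1 over the unit interval; [t] and [1 - t] are never
    both nonpositive, so the denominator is positive. *)
Definition step (t : R) : R := flat 0 t / (flat 0 t + flat 0 (1 - t)).

Lemma step_den_gt0 t : 0 < flat 0 t + flat 0 (1 - t).
Proof.
case: (ltP 0 t) => t0; first by rewrite ltr_pwDl ?flat_gt0 ?flat_ge0.
by rewrite ltr_wpDl ?flat_gt0 ?flat_ge0// subr_gt0 (le_lt_trans t0).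
Qed.

Lemma class_C_step n : class_C n step.
Proof.
apply: class_CM; first exact: class_C_flat.
apply: class_CV => [t|]; first by rewrite gt_eqF ?step_den_gt0.
apply: class_CD; first exact: class_C_flat.
have := class_C_affine (-1) 1 (class_C_flat n 0).
by congr class_C; apply/funext => t; rewrite mulN1r addrC.
Qed.

Lemma step_eq0 t : t <= 0 -> step t = 0.
Proof. by move=> t0; rewrite /step flat_eq0// mul0r. Qed.

Lemma step_eq1 t : 1 <= t -> step t = 1.
Proof.
move=> t1; rewrite /step (flat_eq0 (x := 1 - t)) ?subr_le0// addr0 divff//.
by rewrite gt_eqF// flat_gt0// (lt_le_trans _ t1).
Qed.

Lemma step_ge0 t : 0 <= step t.
Proof. by rewrite divr_ge0 ?flat_ge0// ltW// step_den_gt0. Qed.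

Lemma step_le1 t : step t <= 1.
Proof. by rewrite ler_pdivrMr ?step_den_gt0// mul1r lerDl flat_ge0. Qed.

Lemma step_ndecr : {homo step : s t / s <= t}.
Proof.
move=> s t st; rewrite ler_pdivrMr ?step_den_gt0// mulrAC ler_pdivlMr ?step_den_gt0//.
rewrite !mulrDr [flat 0 t * flat 0 s]mulrC lerD2l.
apply: ler_pM; rewrite ?flat_ge0//; first exact: flat_ndecr.
by apply: flat_ndecr; rewrite lerB.
Qed.

End SmoothStep.

(** * Products of smooth functions as test functions *)

Section ProductTestFunctions.
Context (R : realType).
Implicit Types (m : nat).

Lemma class_C_derive1 n (f : R -> R) : class_C n.+1 f -> class_C n f^`()%classic.
Proof.
move=> [f' df Cf']; suff -> : f^`()%classic = f' by [].
by apply/funext => x; rewrite derive1E; exact: (derive_val (is_derive := df x)).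
Qed.

Lemma class_C_derive1n n k (f : R -> R) : class_C (n + k) f -> class_C n f^`(k)%classic.
Proof.
elim: k n => [|k IH] n; first by rewrite addn0.
rewrite addnS -addSn => /IH; rewrite derive1nS; exact: class_C_derive1.
Qed.

Lemma class_C_is_derive n (f : R -> R) (x : R) : class_C n.+1 f ->
  is_derive x 1 f (f^`()%classic x).
Proof.
move=> [f' df _].
by rewrite derive1E (derive_val (is_derive := df x)); exact: df.
Qed.

Lemma class_C_continuous n (f : R -> R) : class_C n f -> continuous f.
Proof. by elim: n => // n IH /class_CS. Qed.

(** A directional derivative sees [f] only along a line; the shift [a] lets [g] be a function of the
    moving coordinate itself. *)
Lemma is_derive_line (V : normedModType R) (f : V -> R) (x v : V) (g : R -> R) (a d : R) :
  (forall h, f (h *: v + x) = g (h + a)) -> is_derive a 1 g d -> is_derive x v f d.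
Proof.
move=> fg dg.
have f0 : f x = g a by have := fg 0; rewrite scale0r !add0r.
have e : (fun h : R => h^-1 *: ((f \o shift x) (h *: v) - f x)) =
    (fun h : R => h^-1 *: ((g \o shift a) (h *: 1) - g a)).
  by apply/funext => h; rewrite /= fg f0 [h *: 1]mulr1.
split.
  by rewrite /derivable e; exact: (ex_derive (is_derive := dg)).
by rewrite /derive e; exact: (derive_val (is_derive := dg)).
Qed.

Lemma is_derive_prod_coord m (f : 'I_m -> R -> R) (k : 'I_m) (x : 'rV[R]_m) :
  class_C 1 (f k) ->
  is_derive x (delta_mx 0 k) (fun y => \prod_i f i (y 0 i))
    (\prod_i (if i == k then (f i)^`()%classic else f i) (x 0 i)).
Proof.
move=> Cf.
pose C := \prod_(i | i != k) f i (x 0 i).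
apply: (@is_derive_line _ _ x _ (C *: f k) (x 0 k)).
  move=> h; rewrite (bigD1 k)//= mulrC; congr (_ * f k _); last first.
    by rewrite !mxE !eqxx mulr1.
  by apply: eq_bigr => i ik; rewrite !mxE (negbTE ik) andbF mulr0 add0r.
rewrite (bigD1 k)//= eqxx mulrC.
have -> : \prod_(i < m | i != k) (if i == k then (f i)^`()%classic else f i) (x 0 i) = C.
  by apply: eq_bigr => i /negbTE ->.
exact: is_deriveZ (class_C_is_derive _ Cf).
Qed.

Lemma partials_prod_coord m (f : 'I_m -> R -> R) (s : seq 'I_m) :
  (forall i n, class_C n (f i)) ->
  partials s (fun y => \prod_i f i (y 0 i)) =
  (fun y => \prod_i (f i)^`(count_mem i s)%classic (y 0 i)).
Proof.
move=> Cf; elim: s => [|k s IH] //=.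
rewrite IH; apply/funext => x; rewrite /partial.
have Ck : class_C 1 (f k)^`(count_mem k s)%classic by exact: class_C_derive1n.
rewrite (derive_val (is_derive := is_derive_prod_coord x
  (f := fun i => (f i)^`(count_mem i s)%classic) Ck)).
by apply: eq_bigr => i _; rewrite eq_sym; case: (k == i).
Qed.

Lemma smooth_prod_coord m (f : 'I_m -> R -> R) :
  (forall i n, class_C n (f i)) -> smooth (fun y : 'rV[R]_m => \prod_i f i (y 0 i)).
Proof.
move=> Cf s; rewrite partials_prod_coord//; split.
  apply: (@continuous_prod_coord _ _ (fun i => (f i)^`(count_mem i s)%classic)) => i.
  exact: (@class_C_continuous 0) (class_C_derive1n _).
move=> k x.
have Ck : class_C 1 (f k)^`(count_mem k s)%classic by exact: class_C_derive1n.
exact: (ex_derive (is_derive := is_derive_prod_coord x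
  (f := fun i => (f i)^`(count_mem i s)%classic) Ck)).
Qed.

Lemma test_function_prod m (f : 'I_m -> R -> R) (a b : 'I_m -> R) :
  (forall i, 0 < a i) ->
  (forall i n, class_C n (f i)) ->
  (forall i t, f i t != 0 -> a i <= t <= b i) ->
  test_function (fun y : 'rV[R]_m => \prod_i f i (y 0 i)).
Proof.
move=> a0 Cf fab.
pose K := [set y : 'rV[R]_m | forall i, `[a i, b i]%classic (y ord0 i)].
have cK : compact K.
  apply: (@rV_compact _ _ (fun i => `[a i, b i]%classic)) => i.
  exact: segment_compact.
have hausR : hausdorff_space 'rV[R]_m by exact: norm_hausdorff.
have clK : closed K by exact: compact_closed.
have sK : closure [set y : 'rV[R]_m | \prod_i f i (y 0 i) != 0] `<=` K.
  rewrite ((closure_id K).1 clK); apply: closure_subset => y /= fy i /=; rewrite in_itv/=.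
  apply: fab; apply: contraNneq fy => fi.
  by rewrite (bigD1 i)//= fi mul0r.
split; first exact: smooth_prod_coord.
- by apply: subclosed_compact cK sK; exact: closed_closure.
- by move=> y /sK Ky i; have := Ky i; rewrite /= in_itv/= => /andP[+ _]; exact: lt_le_trans.
Qed.

End ProductTestFunctions.

(** * Increments over boxes *)

Section Ramp.
Context (R : realType).
Implicit Types (L c t : R).

(** The offset [c] places the transition: [- 1] puts it on [1/L, 2/L], and [2 - L * x] puts it on
    [x - 2/L, x - 1/L]. Both stay strictly inside (0, x) for large [L], and their derivatives
    concentrate at 0 and at [x]. *)
Definition ramp L c t : R := step (L * t + c).

Lemma class_C_ramp n L c : class_C n (ramp L c).
Proof. exact/class_C_affine/class_C_step. Qed.

Lemma ramp_ndecr L c : 0 <= L -> {homo ramp L c : s t / s <= t}.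
Proof. by move=> L0 s t st; apply: step_ndecr; rewrite lerD2r ler_wpM2l. Qed.

Lemma derive_ramp_ge0 L c t : 0 <= L -> 0 <= (ramp L c)^`()%classic t.
Proof.
move=> L0; apply: ndecr_is_derive_ge0 (ramp_ndecr c L0) _.
exact: class_C_is_derive (class_C_ramp 1 L c).
Qed.

Lemma derive_step_eq0 t : (t < 0) || (1 < t) -> (@step R)^`()%classic t = 0.
Proof.
move=> t01; rewrite derive1E; case/orP: t01 => t01.
  rewrite (@near_eq_derive _ _ _ _ (cst (0 : R))) ?derive_cst//.
  by near=> y; rewrite step_eq0// ltW//; near: y; exact: lt_nbhsl.
rewrite (@near_eq_derive _ _ _ _ (cst (1 : R))) ?derive_cst//.
by near=> y; rewrite step_eq1// ltW//; near: y; exact: lt_nbhsr.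
Unshelve. all: by end_near. Qed.

Lemma derive_ramp_neq0 L c t : (ramp L c)^`()%classic t != 0 -> 0 <= L * t + c <= 1.
Proof.
apply: contraR; rewrite negb_and -!ltNge => h.
have ds := class_C_is_derive (L * t + c) (class_C_step R 1).
have := is_derive1_comp (g := fun t => L * t + c) ds (is_derive_affine L c t).
move=> d; rewrite derive1E (derive_val (is_derive := d)).
by rewrite derive_step_eq0// mul0r.
Qed.

Lemma continuous_derive_ramp L c : continuous (ramp L c)^`()%classic.
Proof. exact: (@class_C_continuous _ 0) (class_C_derive1 (class_C_ramp 1 L c)). Qed.

Lemma Rintegral_derive_ramp L c : 0 < L ->
  \int[@lebesgue_measure R]_t (ramp L c)^`()%classic t = 1.
Proof.
move=> L0; pose a := - c / L; pose b := (1 - c) / L.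
have ab : a < b by rewrite ltr_pM2r ?invr_gt0//; lra.
have -> : \int[@lebesgue_measure R]_t (ramp L c)^`()%classic t =
    \int[@lebesgue_measure R]_(t in `[a, b]) (ramp L c)^`()%classic t.
  rewrite [RHS]Rintegral_mkcond; congr (Rintegral _ _ _); apply/funext => t.
  rewrite patchE; case: ifPn => //.
  rewrite notin_setE/= in_itv/= => h; apply/eqP/negPn/negP => /derive_ramp_neq0 h'.
  apply: h; rewrite ler_pdivrMr// ler_pdivlMr// [t * L]mulrC.
  by move: h' => /andP[]; lra.
have cr : continuous (ramp L c) := class_C_continuous (class_C_ramp 0 L c).
rewrite /Rintegral (continuous_FTC2 (F := ramp L c) ab).
- rewrite /ramp /a /b !(mulrCA L) divff ?gt_eqF// !mulr1 subrK addNr.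
  by rewrite step_eq1// step_eq0//= subr0.
- by apply: continuous_subspaceT; exact: continuous_derive_ramp.
- split.
  + by move=> x _; exact: (ex_derive (is_derive := class_C_is_derive x (class_C_ramp 1 L c))).
  + by apply: cvg_at_right_filter; exact: cr.
  + by apply: cvg_at_left_filter; exact: cr.
- by [].
Qed.

End Ramp.

(** * Approximate Dirac masses at the vertices of a box *)

Section Corners.
Context (R : realType).

Definition corner m (J : {set 'I_m}) (x : 'rV[R]_m) : 'rV[R]_m :=
  \row_i (if i \in J then x 0 i else 0).

Lemma dist_corner_derive_ramp L b (a t : R) : 0 < L ->
  (ramp L (if b then 2 - L * a else - 1))^`()%classic t != 0 ->
  `|t - (if b then a else 0)| <= 2 / L.
Proof.
move=> L0 /derive_ramp_neq0 h; rewrite ler_pdivlMr// -[X in _ * X](gtr0_norm L0) -normrM.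
by rewrite ler_norml mulrBl; move: h; case: b => /andP[]; lra.
Qed.

(** The sum of all |x_i| is a crude bound for each of them; it gives a single support radius valid
    for every [i] and [J]. *)
Lemma derive_ramp_corner_eq0 m (x : 'rV[R]_m) (J : {set 'I_m}) L i t : 0 < L ->
  \sum_i `|x 0 i| + 2 / L < `|t| ->
  (ramp L (if i \in J then 2 - L * x 0 i else - 1))^`()%classic t = 0.
Proof.
move=> L0; apply: contraTeq => /(dist_corner_derive_ramp L0); rewrite -leNgt => h.
have xs : `|if i \in J then x 0 i else 0| <= \sum_i `|x 0 i|.
  rewrite (bigD1 i)//=; case: ifP => _; rewrite ?normr0 ?lerDl ?sumr_ge0//.
  by rewrite addr_ge0// sumr_ge0.
rewrite -[t](subrK (if i \in J then x 0 i else 0)) (le_trans (ler_normD _ _))//.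
by rewrite addrC lerD.
Qed.

Lemma cvg_lebesgue_rV_corner m (g : 'rV[R]_m -> R) (x : 'rV[R]_m) (J : {set 'I_m}) (L0 : R) :
  0 < L0 -> continuous g ->
  lebesgue_rV (fun y => g y * \prod_i
    (ramp (L0 + k%:R) (if i \in J then 2 - (L0 + k%:R) * x 0 i else - 1))^`()%classic (y 0 i))
    @[k --> \oo] --> g (corner J x).
Proof.
move=> L00 cg; apply/cvgrPdist_le => e e0.
have /cvgrPdist_le/(_ _ e0) := cg (corner J x).
move=> /nbhs_ballP[d /= d0 gd].
near=> k; set L := L0 + k%:R.
have L_gt0 : 0 < L by rewrite ltr_wpDr.
have Ld : 2 / L < d.
  rewrite ltr_pdivrMr// -ltr_pdivrMl// mulrC.
  rewrite (@lt_le_trans _ _ k%:R)//; last by rewrite lerDr ltW.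
  by near: k; exact: nbhs_infty_gtr.
have M0 : 0 <= \sum_i `|x 0 i| + 2 / L by rewrite addr_ge0// ?sumr_ge0// divr_ge0// ltW.
rewrite distrC.
apply: (dist_lebesgue_rV_prod (w := fun i => (ramp L
    (if i \in J then 2 - L * x 0 i else - 1))^`()%classic) M0) => //.
- by move=> i; exact: continuous_derive_ramp.
- by move=> i t; exact: derive_ramp_corner_eq0.
- by move=> i t; apply: derive_ramp_ge0; exact: ltW.
- by move=> i; exact: Rintegral_derive_ramp.
- move=> y wy; rewrite distrC; apply: gd; split=> // i j; rewrite [i]ord1.
  rewrite /ball/= distrC mxE.
  by rewrite (le_lt_trans (dist_corner_derive_ramp L_gt0 (wy j))).
Unshelve. all: by end_near. Qed.

End Corners.

Section Bump.
Context (R : realType).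
Implicit Types (L x t : R).

(* For [3 <= L * x], a smooth version of the indicator of [(0, x)], carried by
   [[1 / L, x - 1 / L]] and equal to [1] on [[2 / L, x - 2 / L]]. *)
Definition bump L x t : R := ramp L (- 1) t + cst (- 1) t * ramp L (2 - L * x) t.

Lemma class_C_bump n L x : class_C n (bump L x).
Proof.
apply: class_CD; first exact: class_C_ramp.
by apply: class_CM; [exact: class_C_cst|exact: class_C_ramp].
Qed.

Lemma derive_bump L x t : (bump L x)^`()%classic t =
  - (ramp L (2 - L * x))^`()%classic t + (ramp L (- 1))^`()%classic t.
Proof.
have d1 := class_C_is_derive t (class_C_ramp 1 L (-1)).
have d2 := class_C_is_derive t (class_C_ramp 1 L (2 - L * x)).
have d := is_deriveD d1 (is_deriveM (is_derive_cst (-1 : R) t 1) d2).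
rewrite [LHS]derive1E [LHS](derive_val (is_derive := d)) scaler0 addr0.
by rewrite addrC /cst [_ *: _]mulN1r.
Qed.

Lemma norm_bump_le1 L x t : `|bump L x t| <= 1.
Proof.
rewrite /bump /ramp /cst mulN1r.
have := (step_ge0 (L * t + -1), step_le1 (L * t + -1),
  step_ge0 (L * t + (2 - L * x)), step_le1 (L * t + (2 - L * x))).
by rewrite ler_norml => -[[[a b] c] d]; lra.
Qed.

(** The constant 3 is what makes the two ramps cancel outside: below 1/L both are still 0, and above
    x - 1/L both have reached 1. *)
Lemma bump_neq0 L x t : 0 < L -> 3 <= L * x -> bump L x t != 0 ->
  L^-1 <= t <= x - L^-1.
Proof.
move=> L0 Lx; apply: contraR; rewrite negb_and -!ltNge => /orP h.
rewrite -(inj_eq (mulfI (lt0r_neq0 L0))) mulr0 mulf_eq0 gt_eqF//=.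
rewrite /bump /ramp /cst mulN1r.
case: h => [|].
  rewrite -[_^-1]mul1r ltr_pdivlMr// mulrC => tL.
  by rewrite !step_eq0 ?subr0//; lra.
rewrite -(ltr_pM2l L0) mulrBr (mulfV (lt0r_neq0 L0)) => tL.
by rewrite !step_eq1 ?subrr//; lra.
Qed.

Lemma bump_eq1 L x t : 2 <= L * t -> 2 <= L * (x - t) -> bump L x t = 1.
Proof.
move=> Lt; rewrite mulrBr => Lxt.
rewrite /bump /ramp /cst mulN1r step_eq1; last lra.
by rewrite step_eq0 ?subr0//; lra.
Qed.

End Bump.

Section BoxIncrements.
Context (R : realType).

Definition open_box m (x : 'rV[R]_m) : set 'rV[R]_m :=
  [set y | forall i, 0 < y 0 i < x 0 i].

(** The usual sign (-1)^(m - |J|) is split so that the outer factor matches the one in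
    [is_mixed_derivative]. *)
Definition box_increment m (g : 'rV[R]_m -> R) (x : 'rV[R]_m) : R :=
  (-1) ^+ m * \sum_(J : {set 'I_m}) (-1) ^+ #|J| * g (corner J x).

(** Each factor becomes a difference of two densities. In the expanded product, [J] collects the
    coordinates where the density near [x 0 i] was taken, each with a minus sign. *)
Lemma partials_bump m (L : R) (x : 'rV[R]_m) :
  partials (enum 'I_m) (fun y => \prod_i bump L (x 0 i) (y 0 i)) =
  (fun y => \sum_(J : {set 'I_m}) (-1) ^+ #|J| *
    \prod_i (ramp L (if i \in J then 2 - L * x 0 i else - 1))^`()%classic (y 0 i)).
Proof.
rewrite (@partials_prod_coord _ _ (fun i => bump L (x 0 i))); last first.
  by move=> i n; exact: class_C_bump.
apply/funext => y.
under eq_bigr => i _.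
  rewrite count_uniq_mem ?enum_uniq// mem_enum inE derive1n1 derive_bump; over.
rewrite bigA_distr; apply: eq_bigr => J _.
transitivity (\prod_i ((if i \in J then - 1 else 1) *
    (ramp L (if i \in J then 2 - L * x 0 i else - 1))^`()%classic (y 0 i))).
  by apply: eq_bigr => i _; case: ifP => _; rewrite ?mulN1r ?mul1r.
by rewrite big_split/= -big_mkcond/= prodr_const.
Qed.

Lemma cvg_lebesgue_rV_bump m (g : 'rV[R]_m -> R) (x : 'rV[R]_m) (L0 : R) :
  0 < L0 -> continuous g ->
  (-1) ^+ m * lebesgue_rV (fun y => g y * partials (enum 'I_m)
    (fun y => \prod_i bump (L0 + k%:R) (x 0 i) (y 0 i)) y)
    @[k --> \oo] --> box_increment g x.
Proof.
move=> L00 cg.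
have cgJ (J : {set 'I_m}) : continuous (fun y => (-1) ^+ #|J| * g y).
  by move=> y; exact: cvgM (cvg_cst _) (cg y).
have E (k : nat) : lebesgue_rV (fun y => g y * partials (enum 'I_m)
    (fun y => \prod_i bump (L0 + k%:R) (x 0 i) (y 0 i)) y) =
    \sum_(J : {set 'I_m}) lebesgue_rV (fun y => (-1) ^+ #|J| * g y * \prod_i
      (ramp (L0 + k%:R) (if i \in J then 2 - (L0 + k%:R) * x 0 i else - 1))^`()%classic
      (y 0 i)).
  rewrite partials_bump; set L := L0 + k%:R.
  have L_gt0 : 0 < L by rewrite ltr_wpDr.
  under [X in lebesgue_rV X]eq_fun => y.
    rewrite mulr_sumr; under eq_bigr do rewrite mulrCA mulrA; over.
  apply: (@lebesgue_rV_sum _ _ (\sum_i `|x 0 i| + 2 / L)).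
    by rewrite addr_ge0// ?sumr_ge0// divr_ge0// ltW.
  move=> J; apply: (supported_in_prod (w := fun i => (ramp L
    (if i \in J then 2 - L * x 0 i else - 1))^`()%classic)) => //.
  - by move=> i; exact: continuous_derive_ramp.
  - by move=> i t; exact: derive_ramp_corner_eq0.
under eq_fun do rewrite E.
apply: cvgM; first exact: cvg_cst.
apply: cvg_big => [|J _]; first exact: add_continuous.
exact: (@cvg_lebesgue_rV_corner _ _ (fun y => (-1) ^+ #|J| * g y)).
Qed.

Lemma continuous_measurable_rV m (f : 'rV[R]_m -> R) : continuous f ->
  measurable_fun [set: borel_rV R m] f.
Proof.
move=> /continuousP cf; apply: (measurability _ (RGenOpens.measurableE R)).
move=> _ [_ [a [b ->] <-]]; rewrite setTI; apply: sub_sigma_algebra.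
exact/cf/interval_open.
Qed.

Lemma measurable_open_box m (x : 'rV[R]_m) : measurable (open_box x : set (borel_rV R m)).
Proof.
have -> : open_box x =
    \bigcap_(i in [set: 'I_m]) ((fun y : borel_rV R m => y 0 i) @^-1` `]0, x 0 i[).
  apply/seteqP; split=> y; first by move=> yx i _ /=; rewrite in_itv/=; exact: yx.
  by move=> yx i; have := yx i I; rewrite /= in_itv.
apply: fin_bigcap_measurable => // i _.
rewrite -[X in measurable X]setTI; apply: continuous_measurable_rV => //.
exact: coord_continuous.
Qed.

End BoxIncrements.

(** * Box masses of the mixed derivative *)

Section BoxMeasure.
Context (R : realType).

Lemma prod_bump_out m (L : R) (x y : 'rV[R]_m) : 0 < L -> (forall i, 3 <= L * x 0 i) ->
  ~ open_box x y -> \prod_i bump L (x 0 i) (y 0 i) = 0.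
Proof.
move=> L0 Lx /existsNP[i yi]; rewrite (bigD1 i)//=.
suff -> : bump L (x 0 i) (y 0 i) = 0 by rewrite mul0r.
apply/eqP/negPn/negP => /(bump_neq0 L0 (Lx i)) /andP[h1 h2]; apply: yi.
have L'0 : 0 < L^-1 by rewrite invr_gt0.
by apply/andP; split; lra.
Qed.

Lemma norm_prod_bump_le m (L : R) (x y : 'rV[R]_m) : 0 < L ->
  (forall i, 3 <= L * x 0 i) ->
  `|\prod_i bump L (x 0 i) (y 0 i)| <= \1_(open_box x) y.
Proof.
move=> L0 Lx; rewrite indicE; case: (pselect (open_box x y)) => xy.
  rewrite mem_set// normr_prod; apply: prodr_ile1 => i _.
  by rewrite normr_ge0 norm_bump_le1.
by rewrite memNset// prod_bump_out// normr0.
Qed.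

Lemma cvg_prod_bump m (L0 : R) (x y : 'rV[R]_m) : 0 < L0 -> (forall i, 3 <= L0 * x 0 i) ->
  \prod_i bump (L0 + k%:R) (x 0 i) (y 0 i) @[k --> \oo] --> (\1_(open_box x) y : R).
Proof.
move=> L00 Lx; rewrite indicE.
have Lnear a : 0 < a -> \forall k \near \oo, 2 <= (L0 + k%:R) * a.
  move=> a0; near=> k; rewrite -ler_pdivrMr//.
  apply: (@le_trans _ _ k%:R); last by rewrite lerDr ltW.
  by near: k; exact: nbhs_infty_ger.
case: (pselect (open_box x y)) => xy.
  rewrite mem_set//=; apply: cvg_near_cst.
  have : \forall k \near \oo, forall i : 'I_m,
      2 <= (L0 + k%:R) * y 0 i /\ 2 <= (L0 + k%:R) * (x 0 i - y 0 i).
    apply: filter_forall => i; have /andP[yi0 yix] := xy i.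
    rewrite -subr_gt0 in yix.
    by near=> k; split; near: k; exact: Lnear.
  apply: filterS => k Lk; apply: big1 => i _.
  by have [] := Lk i; exact: bump_eq1.
rewrite memNset//=; apply: cvg_near_cst; apply: nearW => k.
apply: prod_bump_out => // [|i]; first by rewrite ltr_wpDr.
rewrite mulrDl (le_trans (Lx i))// lerDl mulr_ge0//.
by rewrite -(pmulr_rge0 _ L00) (le_trans _ (Lx i)).
Unshelve. all: by end_near. Qed.

Lemma cvg_Rintegral_bump m (mu : {measure set (borel_rV R m) -> \bar R})
  (L0 : R) (x : 'rV[R]_m) : 0 < L0 -> (forall i, 3 <= L0 * x 0 i) ->
  (mu (open_box x) < +oo)%E ->
  \int[mu]_y (\prod_i bump (L0 + k%:R) (x 0 i) (y 0 i)) @[k --> \oo] -->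
  fine (mu (open_box x)).
Proof.
move=> L00 Lx mux.
have Lk0 (k : nat) : 0 < L0 + k%:R by rewrite ltr_wpDr.
have Lkx (k : nat) i : 3 <= (L0 + k%:R) * x 0 i.
  rewrite mulrDl (le_trans (Lx i))// lerDl mulr_ge0//.
  by rewrite -(pmulr_rge0 _ L00) (le_trans _ (Lx i)).
have mbox := measurable_open_box x.
have [] := @dominated_convergence _ _ _ mu setT measurableT
  (fun k y => (\prod_i bump (L0 + k%:R) (x 0 i) (y 0 i))%:E)
  (fun y => (\1_(open_box x) y)%:E) (fun y => (\1_(open_box x) y)%:E).
- move=> k; apply/measurable_EFinP; apply: continuous_measurable_rV.
  apply: (continuous_prod_coord (w := fun i => bump (L0 + k%:R) (x 0 i))) => i.
  exact: (class_C_continuous (class_C_bump 0 _ _)).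
- by apply/measurable_EFinP; exact: measurable_indic.
- by apply: aeW => y _; apply: cvg_EFin; [exact: nearW|exact: cvg_prod_bump].
- apply/integrableP; split.
    by apply/measurable_EFinP; exact: measurable_indic.
  under eq_integral do rewrite gee0_abs ?lee_fin//.
  by rewrite integral_indic// setIT.
- by apply: aeW => y k _; rewrite lee_fin norm_prod_bump_le.
move=> _ _; rewrite integral_indic// setIT -{1}(@fineK _ (mu (open_box x))) ?ge0_fin_numE//.
exact: fine_cvg.
Qed.

(** [g] stands for a continuous extension of the face restriction of [h]: the limit at the vertices
    asks for continuity everywhere, while [is_mixed_derivative] speaks of [h] itself. *)
Lemma mixed_derivative_open_box n (h : 'rV[R]_n -> R) (z d : {set 'I_n})
  (mu : signed_radon R #|d|) (g : 'rV[R]_#|d| -> R) (x : 'rV[R]_#|d|) :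
  is_mixed_derivative h z mu -> continuous g ->
  (forall y : 'rV[R]_#|d|, (forall i, 0 <= y 0 i) -> g y = h (face z y)) ->
  (forall i, 0 < x 0 i) ->
  (radon_pos mu (open_box x) < +oo)%E -> (radon_neg mu (open_box x) < +oo)%E ->
  fine (radon_pos mu (open_box x)) - fine (radon_neg mu (open_box x)) =
  box_increment g x.
Proof.
move=> hmu cg gh x0 mup mun.
have [L0 L00 Lx] : exists2 L0 : R, 0 < L0 & forall i, 3 <= L0 * x 0 i.
  (* The sum exceeds each [3 / x 0 i]; the 1 keeps [L0] positive even with no coordinates. *)
  exists (1 + \sum_i 3 / x 0 i).
    by rewrite ltr_pwDl// sumr_ge0// => i _; rewrite divr_ge0// ltW.
  move=> i; rewrite -ler_pdivrMr// (bigD1 i)//= addrCA lerDl addr_ge0// sumr_ge0//.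
  by move=> j _; rewrite divr_ge0// ltW.
have Lk0 (k : nat) : 0 < L0 + k%:R by rewrite ltr_wpDr.
have Lkx (k : nat) i : 3 <= (L0 + k%:R) * x 0 i.
  by rewrite mulrDl (le_trans (Lx i))// lerDl mulr_ge0// ltW.
have c1 := @cvg_lebesgue_rV_bump _ _ g x _ L00 cg.
suff c2 : (-1) ^+ #|d| * lebesgue_rV (fun y => g y * partials (enum 'I_#|d|)
    (fun y => \prod_i bump (L0 + k%:R) (x 0 i) (y 0 i)) y) @[k --> \oo] -->
    fine (radon_pos mu (open_box x)) - fine (radon_neg mu (open_box x)).
  exact: (cvg_unique _ c2 c1).
rewrite [X in X @ _](_ : _ = (fun k =>
    \int[radon_pos mu]_y (\prod_i bump (L0 + k%:R) (x 0 i) (y 0 i)) -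
    \int[radon_neg mu]_y (\prod_i bump (L0 + k%:R) (x 0 i) (y 0 i)))).
  exact: cvgB (cvg_Rintegral_bump L00 Lx mup) (cvg_Rintegral_bump L00 Lx mun).
apply/funext => k.
have tk : test_function (fun y : 'rV[R]__ => \prod_i bump (L0 + k%:R) (x 0 i) (y 0 i)).
  apply: (test_function_prod (f := fun i => bump (L0 + k%:R) (x 0 i))
    (a := fun=> (L0 + k%:R)^-1) (b := fun i => x 0 i - (L0 + k%:R)^-1)).
  - by move=> i; rewrite invr_gt0.
  - by move=> i r; exact: class_C_bump.
  - by move=> i t; exact: bump_neq0.
rewrite (hmu _ tk); congr (_ * lebesgue_rV _); apply/funext => y.
case: (pselect (forall i, 0 <= y 0 i)) => [/gh -> //|/existsNP[i yi]].
rewrite (@partials_prod_coord _ _ (fun i => bump (L0 + k%:R) (x 0 i))); last first.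
  by move=> j r; exact: class_C_bump.
rewrite (bigD1 i)//= count_uniq_mem ?enum_uniq// mem_enum inE derive1n1 derive_bump.
have y0 : y 0 i < 0 by rewrite ltNge; apply/negP.
have Ly0 : (L0 + k%:R) * y 0 i < 0 by rewrite pmulr_rlt0.
(* Both offsets, [- 1] and [2 - L * x], are nonpositive, so at a negative coordinate each ramp is
   locally constant. This removes the points where [g] and [h] may differ. *)
have r0 c : c <= 0 -> (ramp (L0 + k%:R) c)^`()%classic (y 0 i) = 0.
  move=> c0; apply/eqP/negPn/negP => /derive_ramp_neq0 /andP[+ _].
  by rewrite leNgt (le_lt_trans _ Ly0)// gerDl.
rewrite !r0 ?oppr0 ?addr0 ?mul0r ?mulr0//.
by have := Lkx k i; lra.
Qed.

End BoxMeasure.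

(** * Integration against the law of the prices *)

Section SigmaFinite.
Context d (T : measurableType d) (R : realType) (nu : {measure set T -> \bar R}).

(** An alias carrying the proof of sigma-finiteness, so that the structure required by Tonelli can
    be attached to it. *)
Definition sigma_finite_of of sigma_finite setT nu : set T -> \bar R := nu.

Variable sf : sigma_finite setT nu.

HB.instance Definition _ := Measure.on (sigma_finite_of sf).
HB.instance Definition _ :=
  Measure_isSigmaFinite.Build _ _ _ (sigma_finite_of sf) sf.

End SigmaFinite.

Section Tonelli.
Context (R : realType) (disp : measure_display) (Omega : measurableType disp)
  (Q : probability Omega R) (n : nat) (X : 'I_n -> {RV Q >-> R}) (d : {set 'I_n}).

Definition subvector (w : Omega) : 'rV[R]_#|d| := \row_i X (enum_val i) w.

Lemma measurable_pos_orthant m : measurable (@pos_orthant R m : set (borel_rV R m)).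
Proof.
have -> : @pos_orthant R m =
    \bigcap_(i in [set: 'I_m]) ((fun y : borel_rV R m => y 0 i) @^-1` `]0, +oo[).
  apply/seteqP; split=> y; first by move=> y0 i _; rewrite /= in_itv/= andbT; exact: y0.
  by move=> y0 i; have := y0 i I; rewrite /= in_itv/= andbT.
apply: fin_bigcap_measurable => // i _.
rewrite -[X in measurable X]setTI; apply: continuous_measurable_rV => //.
exact: coord_continuous.
Qed.

Let below : set (Omega * borel_rV R #|d|) :=
  [set p | forall i, (p.2 : 'rV[R]_#|d|) 0 i < X (enum_val i) p.1].

Let measurable_below : measurable below.
Proof.
have -> : below = \bigcap_(i in [set: 'I_#|d|])
    ((fun p : Omega * borel_rV R #|d| => (p.2 : 'rV[R]_#|d|) 0 i < X (enum_val i) p.1)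
      @^-1` [set true]).
  by apply/seteqP; split=> [p pX i _|p pX i]; [exact: pX|exact: (pX i I)].
apply: fin_bigcap_measurable => // i _.
rewrite -[X in measurable X]setTI; apply: measurable_fun_ltr => //.
- apply: (measurableT_comp (f := fun y : borel_rV R #|d| => y 0 i)) => //.
  by apply: continuous_measurable_rV; exact: coord_continuous.
- exact: (measurableT_comp (f := X (enum_val i))).
Qed.

Lemma measurable_joint_tail (D : set (borel_rV R #|d|)) :
  measurable_fun D (@joint_tail R disp Omega Q n X d).
Proof.
apply: measurable_funTS.
have -> : @joint_tail R disp Omega Q n X d = Q \o ysection below.
  by apply/funext => y; rewrite /= ysectionE.
exact: measurable_fun_ysection.
Qed.

(** Its section at a scenario is the open box spanned by the prices; its section at a point [y] of
    the orthant is the event measured by [joint_tail]. *)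
Let above : set (Omega * borel_rV R #|d|) := below `&` (setT `*` @pos_orthant R #|d|).

Let measurable_above : measurable above.
Proof.
by apply: measurableI => //; apply: measurableX => //; exact: measurable_pos_orthant.
Qed.

Let xsection_above w : xsection above w = open_box (subvector w).
Proof.
rewrite xsectionE; apply/seteqP; split=> [y [yX [_ y0]] i|y yX].
  by rewrite mxE (yX i) y0.
by split; [|split=> //] => i; have := yX i; rewrite mxE => /andP[].
Qed.

Lemma measurable_open_box_subvector (nu : {measure set (borel_rV R #|d|) -> \bar R}) :
  sigma_finite setT nu -> measurable_fun setT (fun w => nu (open_box (subvector w))).
Proof.
move=> sf.
pose nu' : {sigma_finite_measure set (borel_rV R #|d|) -> \bar R} := sigma_finite_of sf.
have -> : (fun w => nu (open_box (subvector w))) = nu' \o xsection above.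
  by apply/funext => w; rewrite /= xsection_above.
exact: measurable_fun_xsection.
Qed.

Lemma integral_joint_tail (nu : {measure set (borel_rV R #|d|) -> \bar R}) :
  sigma_finite setT nu ->
  (\int[nu]_(y in @pos_orthant R #|d|) joint_tail X y =
   \int[Q]_w nu (open_box (subvector w)))%E.
Proof.
move=> sf.
pose nu' : {sigma_finite_measure set (borel_rV R #|d|) -> \bar R} := sigma_finite_of sf.
have := @indic_fubini_tonelli _ _ _ _ R Q nu' above measurable_above.
rewrite indic_fubini_tonelli_FE// indic_fubini_tonelli_GE//.
under eq_integral do rewrite /= xsection_above.
move=> ->; rewrite integral_mkcond; apply: eq_integral => y _.
rewrite patchE/= ysectionE; case: ifPn => [|]; rewrite ?inE ?notin_setE => y0.
  congr (Q _); apply/seteqP; split=> [w /= yw|w [yw _] //].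
  by split.
by rewrite (_ : _ @^-1` _ = set0) ?measure0//; apply/seteqP; split=> // w [_ []].
Qed.

End Tonelli.

(** The cubes [1/(k+1), k+1]^m are compact and exhaust the open orthant. Adding its null complement
    to each of them covers the whole space at no cost in mass. *)
Lemma sigma_finite_radon (R : realType) m (mu : signed_radon R m) :
  sigma_finite setT (radon_pos mu) /\ sigma_finite setT (radon_neg mu).
Proof.
pose K (k : nat) := [set y : 'rV[R]_m | forall i, `[k.+1%:R^-1, k.+1%:R]%classic (y ord0 i)].
have cK k : compact (K k).
  apply: (@rV_compact R m (fun=> `[(k.+1%:R^-1 : R), k.+1%:R]%classic)) => _.
  exact: segment_compact.
have K0 k : K k `<=` @pos_orthant R m.
  by move=> y yK i; have := yK i; rewrite /= in_itv/= => /andP[+ _]; apply: lt_le_trans.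
have mK k : measurable (K k : set (borel_rV R m)).
  rewrite -[K k]setCK; apply: measurableC; apply: sub_sigma_algebra.
  by apply: closed_openC; apply: compact_closed (cK k); exact: norm_hausdorff.
have cover : [set: borel_rV R m] = \bigcup_k (~` @pos_orthant R m `|` K k).
  apply/seteqP; split=> // y _.
  case: (pselect (@pos_orthant R m y)) => y0; last by exists 0%N => //; left.
  have [N yN] : exists N : nat, forall i, (y 0 i)^-1 + y 0 i <= N.+1%:R.
    (* One integer bounds both [y 0 i] and its inverse for all [i], which handles both ends of the
       cube. *)
    exists (Num.truncn (\sum_i ((y 0 i)^-1 + y 0 i))) => i.
    apply: le_trans (ltW (truncnS_gt _)).
    rewrite (bigD1 i)//= lerDl sumr_ge0// => j _.
    by apply: addr_ge0; rewrite ?invr_ge0; apply: ltW; exact: y0.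
  exists N => //; right => i /=; rewrite in_itv/=.
  have yi := y0 i; have := yN i => h.
  rewrite invf_ple ?posrE//; apply/andP; split; apply: le_trans h.
    by rewrite lerDl ltW.
  by rewrite lerDr invr_ge0 ltW.
have sub (nu : {measure set (borel_rV R m) -> \bar R}) :
    nu (~` @pos_orthant R m) = 0%E -> (forall k, nu (K k) < +oo)%E -> sigma_finite setT nu.
  move=> nu0 nuK; exists (fun k => ~` @pos_orthant R m `|` K k) => // k; split.
    by apply: measurableU => //; apply: measurableC; exact: measurable_pos_orthant.
  rewrite setUC measureU0//.
  by apply: measurableC; exact: measurable_pos_orthant.
have [c1 c2] := radon_carrier mu.
by split; apply: sub => // k; have [] := radon_locally_finite mu (cK k) (@K0 k).
Qed.

(** * Integrals and null sets *)

Section AlmostEverywhereIntegral.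
Local Open Scope ereal_scope.
Context d (T : measurableType d) (R : realType) (mu : {measure set T -> \bar R}).
Import HBNNSimple.

(** The integral of a nonnegative function is a supremum over simple functions. A simple function
    below [f], cut to 0 on [N], keeps its integral and lies below [g]. *)
Let ge0_le_integral_off_null (f g : T -> \bar R) (N : set T) :
  (forall x, 0 <= f x) -> (forall x, 0 <= g x) ->
  measurable N -> mu N = 0 -> (forall x, ~ N x -> f x = g x) ->
  \int[mu]_x f x <= \int[mu]_x g x.
Proof.
move=> f0 g0 mN N0 fg.
rewrite ge0_integralTE// ge0_integralTE//.
apply: ge_ereal_sup => _ [s /= sf <-].
have mCN : measurable (~` N) by exact: measurableC.
apply: ereal_sup_ubound; exists (proj_nnsfun s mCN).
  move=> x /=; rewrite mindicE; have [|_] := boolP (x \in ~` N).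
    by rewrite inE mulr1 => Nx; rewrite -fg.
  by rewrite mulr0.
rewrite -!integralT_nnsfun; apply: ge0_ae_eq_integral => //=.
- apply/measurable_EFinP; exact: (measurable_funPT (proj_nnsfun s mCN)).
- by apply/measurable_EFinP; exact: measurable_funPT.
- by move=> x _; rewrite mindicE lee_fin mulr_ge0.
- by move=> x _; rewrite lee_fin.
exists N; split=> // x /= /not_implyP[_]; apply: contra_notP => Nx.
by rewrite mindicE mem_set//= mulr1.
Qed.

(* No measurability is assumed: the payoff is arbitrary off the orthant, where
   prices lie with probability zero only. *)
Lemma integral_ae_eq (f g : T -> \bar R) :
  {ae mu, forall x, f x = g x} -> \int[mu]_x f x = \int[mu]_x g x.
Proof.
move=> [N [mN N0 fgN]].
have {fgN}fg x : ~ N x -> f x = g x.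
  by apply: contra_notP => nfg; apply: fgN.
by rewrite integralE [RHS]integralE; congr (_ - _); apply/eqP; rewrite eq_le;
  apply/andP; split; apply: (ge0_le_integral_off_null _ _ mN N0) => // x Nx;
  rewrite !(funeposE, funenegE) fg.
Qed.

End AlmostEverywhereIntegral.

(** * Inclusion-exclusion over the faces *)

Section Moebius.
Context (R : realType).

Lemma moebius_subsets (n : nat) (H : {set 'I_n} -> R) :
  \sum_(d : {set 'I_n}) (-1) ^+ #|d| *
    \sum_(e : {set 'I_n} | e \subset d) (-1) ^+ #|e| * H e = H finset.setT.
Proof.
(* The coefficient of [H e] factors over the points: those in [e] contribute -1, the others -1 + 1 =
   0, so only the full set survives. *)
have inner (e : {set 'I_n}) :
    \sum_(d : {set 'I_n} | e \subset d) (-1) ^+ #|d| = (-1) ^+ n * (e == finset.setT)%:R :> R.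
  transitivity (\prod_(k < n) (-1 + (k \notin e)%:R) : R).
    rewrite bigA_distr big_mkcond/=; apply: eq_bigr => d _.
    case: ifPn => [/fintype.subsetP ed|/subsetPn[k ke kd]].
      rewrite -prodr_const [RHS](bigID (fun k => k \in d))/= [X in _ = _ * X]big1 ?mulr1.
        by apply: eq_bigr => k ->.
      move=> k kd; rewrite (negbTE kd) (contra (ed k))//.
    by rewrite (bigD1 k)//= (negbTE kd) ke mul0r.
  case: eqVneq => [->|eT].
    by under eq_bigr do rewrite inE addr0; rewrite mulr1 prodr_const card_ord.
  have [k ke] : exists k, k \notin e.
    by apply/existsP; apply: contraNT eT => /existsPn h; apply/eqP/setP => k;
       rewrite inE; apply/negPn/h.
  by rewrite (bigD1 k)//= ke addNr mul0r mulr0.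
under eq_bigr do rewrite mulr_sumr.
rewrite (exchange_big_dep xpredT)//=.
under eq_bigr => e _.
  rewrite -mulr_suml inner; over.
rewrite (bigD1 finset.setT)//= eqxx mulr1 cardsT card_ord big1 ?addr0.
  by rewrite mulrA -exprMn mulrNN mulr1 expr1n mul1r.
by move=> e /negbTE ->; rewrite mulr0 mul0r.
Qed.

(** Toggling [i] is an involution of the subsets that preserves the value of [g] and flips the sign,
    so the sum equals its own opposite. *)
Lemma box_increment_eq0 m (g : 'rV[R]_m -> R) (x : 'rV[R]_m) i :
  (forall J : {set 'I_m}, g (corner (i |: J) x) = g (corner (J :\ i) x)) ->
  box_increment g x = 0.
Proof.
move=> gi; rewrite /box_increment.
set S := \sum_J _; suff SN : S = - S by rewrite (_ : S = 0) ?mulr0//; lra.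
pose tog (J : {set 'I_m}) := if i \in J then J :\ i else i |: J.
have togK : involutive tog.
  move=> J; rewrite /tog; have [iJ|iJ] := boolP (i \in J).
    by rewrite finset.in_setD1 eqxx/= finset.setD1K.
  by rewrite finset.setU11 finset.setU1K.
rewrite {1}/S (reindex_inj (inv_inj togK))/= -sumrN; apply: eq_bigr => J _.
rewrite /tog; case: ifPn => iJ.
  rewrite -gi (cardsD1 i J) iJ exprS mulN1r mulNr opprK.
  by rewrite (finset.setUidPr _)// finset.sub1set.
rewrite gi cardsU1 iJ exprS mulN1r mulNr (_ : J :\ i = J)//.
apply/finset.setP => k; rewrite finset.in_setD1.
by case: eqVneq => // ->; rewrite (negbTE iJ).
Qed.

End Moebius.

(** * Extension off the orthant and increments on faces *)

Section Clamp.
Context (R : realType) (n : nat).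
Implicit Types (x : 'rV[R]_n) (h : 'rV[R]_n -> R) (d : {set 'I_n}).

Definition clamp (x : 'rV[R]_n) : 'rV[R]_n := \row_k Num.max (x 0 k) 0.

Lemma clamp_id x : (forall k, 0 <= x 0 k) -> clamp x = x.
Proof. by move=> x0; apply/rowP => k; rewrite mxE max_l. Qed.

Lemma continuous_clamp : continuous clamp.
Proof.
apply: continuous_rV => k x.
have -> : (fun t => clamp t 0 k) = (fun t : 'rV[R]_n => Num.max (t 0 k) 0).
  by apply/funext => t; rewrite mxE.
by apply: continuous_max; [exact: coord_continuous|exact: cst_continuous].
Qed.

Lemma continuous_comp_clamp (h : 'rV[R]_n -> R) :
  {within @nonneg_orthant R n, continuous h} -> continuous (h \o clamp).
Proof.
move=> ch x.
have cx0 (y : 'rV[R]_n) : nonneg_orthant (clamp y).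
  by move=> k; rewrite mxE le_max lexx orbT.
have /subspace_continuousP/(_ _ (cx0 x)) hx := ch.
apply: cvg_comp hx => U; rewrite /within/= => nU.
by apply: (filterS (F := nbhs x) _ (continuous_clamp nU)) => y; exact.
Qed.

Definition restrict_face (d : {set 'I_n}) (x : 'rV[R]_n) : 'rV[R]_#|d| :=
  \row_i x 0 (enum_val i).

Lemma continuous_face (z d : {set 'I_n}) : continuous (@face R n z d).
Proof.
apply: continuous_rV => k.
have -> : (fun y => face z y 0 k) = (fun y : 'rV[R]_#|d| =>
    \sum_(i < #|d| | enum_val i == k) (if k \in z then 0 else 1) * y 0 i).
  apply/funext => y; rewrite mxE; case: ifP => _.
    by rewrite big1// => i _; rewrite mul0r.
  by apply: eq_bigr => i _; rewrite mul1r.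
apply: continuous_big => [|i _ y]; first exact: add_continuous.
exact: cvgM (cvg_cst _) (@coord_continuous _ _ _ 0 i y).
Qed.

Lemma face_corner (d : {set 'I_n}) (J : {set 'I_#|d|}) x :
  face (~: d) (corner J (restrict_face d x)) = corner (enum_val @: J)%SET x.
Proof.
apply/rowP => k; rewrite !mxE finset.in_setC; case: ifPn => kd.
  case: imsetP => // -[i _ ki]; move: kd; rewrite ki enum_valP//.
rewrite negbK in kd.
rewrite (big_pred1 (enum_rank_in kd k)); last first.
  by move=> i; rewrite /= -(inj_eq enum_val_inj) enum_rankK_in.
rewrite !mxE enum_rankK_in//.
by rewrite -(mem_imset J _ enum_val_inj) enum_rankK_in.
Qed.

Definition face_increment (h : 'rV[R]_n -> R) (d : {set 'I_n}) x : R :=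
  box_increment (fun y => h (clamp (face (~: d) y))) (restrict_face d x).

(** Taking images under [enum_val] turns subsets of the coordinates of the face into subsets of [d];
    all faces then share the vertices [corner e x], as the inclusion-exclusion requires. *)
Lemma face_incrementE h d x : face_increment h d x =
  (-1) ^+ #|d| * \sum_(e : {set 'I_n} | e \subset d)
    (-1) ^+ #|e| * h (clamp (corner e x)).
Proof.
rewrite /face_increment /box_increment; congr (_ * _).
rewrite [RHS](reindex_onto (fun J : {set 'I_#|d|} => (enum_val @: J)%SET)
  (fun e : {set 'I_n} => (enum_val @^-1: e)%SET))/=; last first.
  move=> e /fintype.subsetP ed; apply/finset.setP => k; apply/imsetP/idP => [[i]|ke].
    by rewrite finset.inE => ? ->.
  exists (enum_rank_in (ed _ ke) k); rewrite ?finset.inE enum_rankK_in//; exact: ed.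
apply: eq_big => [J|J _].
  apply/esym/andP; split.
    by apply/fintype.subsetP => _ /imsetP[i _ ->]; exact: enum_valP.
  apply/eqP/finset.setP => i; rewrite finset.inE mem_imset//; exact: enum_val_inj.
rewrite card_imset; last exact: enum_val_inj.
by rewrite face_corner.
Qed.

Lemma sum_face_increment h x : \sum_(d : {set 'I_n}) face_increment h d x = h (clamp x).
Proof.
under eq_bigr do rewrite face_incrementE.
rewrite moebius_subsets; congr (h (clamp _)).
by apply/rowP => k; rewrite mxE finset.inE.
Qed.

(** Counterpart of the empty box. After [clamp] the coordinate [k] is 0 whether or not the vertex
    includes it, so vertices cancel in pairs. *)
Lemma face_increment_eq0 h d x k : k \in d -> x 0 k <= 0 -> face_increment h d x = 0.
Proof.
move=> kd xk; apply: (@box_increment_eq0 _ _ _ _ (enum_rank_in kd k)) => J.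
rewrite !face_corner; congr h; apply/rowP => l; rewrite !mxE.
have [->|lk] := eqVneq l k.
  have m0 (b : bool) : Num.max (if b then x 0 k else 0) 0 = 0.
    by apply: max_r; case: b.
  by rewrite !m0.
congr (Num.max _ _); congr (if _ then _ else _).
apply/imsetP/imsetP => -[i iJ li]; exists i => //; move: iJ.
  rewrite finset.in_setD1 finset.in_setU1; case: eqVneq => //= ik.
  by move: lk; rewrite li ik enum_rankK_in ?eqxx.
by rewrite finset.in_setD1 finset.in_setU1 => /andP[_ ->]; rewrite orbT.
Qed.

End Clamp.

Lemma complementaryE n (z d : {set 'I_n}) : (0 < n)%N ->
  complementary z d = (z == ~: d)%SET.
Proof.
move=> n0; rewrite /complementary; apply/andP/eqP => [[/eqP sn /eqP mx1]|->].
  have le1 k : (madd z d k <= 1)%N by rewrite -mx1; exact: leq_bigmax.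
  (* There are [n] terms, each at most 1, with sum [n]: the equality case makes each of them 1. *)
  have /= := leqif_sum (fun k (_ : true) => leqif_eq (le1 k)).
  rewrite sum1_card card_ord => -[_]; rewrite sn eqxx => /esym/forallP h.
  apply/finset.setP => k; rewrite finset.in_setC; have := h k.
  by rewrite /madd; case: (k \in z); case: (k \in d).
have m1 k : madd (~: d)%SET d k = 1%N by rewrite /madd finset.in_setC; case: (k \in d).
split; first by under eq_bigr do rewrite m1; rewrite sum1_card card_ord.
under eq_bigr do rewrite m1.
rewrite eqn_leq; apply/andP; split; first by apply/bigmax_leqP.
exact: (leq_bigmax (F := fun=> 1%N) (Ordinal n0)).
Qed.

(** * The price as a sum of expectations *)

Section Pricing.
Local Open Scope ereal_scope.
Context (R : realType) (disp : measure_display) (Omega : measurableType disp)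
  (Q : probability Omega R) (n : nat) (X : 'I_n -> {RV Q >-> R}).

(** For nonempty [d], [Y] is a difference of extended-real box masses: integrable by Tonelli, and
    equal to the increment where both masses are finite. Its integrability is what later lets the
    finite sum enter the expectation. *)
Lemma valA_integral (h : 'rV[R]_n -> R) (d : {set 'I_n}) :
  {within @nonneg_orthant R n, continuous h} ->
  absA X h (~: d)%SET d < +oo ->
  exists Y : Omega -> \bar R, [/\ Q.-integrable setT Y,
    valA X h (~: d)%SET d = \int[Q]_w Y w &
    {ae Q, forall w, Y w = (face_increment h d (\row_k X k w))%:E}].
Proof.
move=> ch; rewrite /absA /valA; case: eqVneq => [->|d0].
  move=> _; exists (cst (h 0%R)%:E); split.
  - exact: finite_measure_integrable_cst.
  - by rewrite integral_cst// [X in _ * X](probability_setT Q) mule1.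
  - apply: aeW => w; rewrite face_incrementE cards0 expr0 mul1r.
    rewrite (big_pred1 finset.set0) => [|e]; last by rewrite /= finset.subset0.
    rewrite cards0 expr0 mul1r; congr (h _)%:E; apply/rowP => k.
    by rewrite !mxE finset.in_set0 maxxx.
case: pselect => [ex_mu|//]; move: (cid ex_mu) => [mu hmu] /= var_fin.
have [sfp sfn] := sigma_finite_radon mu.
have mpos := @measurable_pos_orthant R #|d|.
pose box w := open_box (subvector X d w).
have jt0 y : 0 <= joint_tail X (d := d) y by exact: measure_ge0.
have [finp finn] : \int[Q]_w radon_pos mu (box w) < +oo /\
    \int[Q]_w radon_neg mu (box w) < +oo.
  rewrite -!integral_joint_tail//.
  move: var_fin; rewrite /radon_variation ge0_integral_measure_add//; last first.
    exact: measurable_joint_tail.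
  by move=> hfin; split; apply: le_lt_trans hfin; rewrite ?leeDl ?leeDr// integral_ge0.
have integrable_box (nu : {measure set (borel_rV R #|d|) -> \bar R}) :
    sigma_finite setT nu -> \int[Q]_w nu (box w) < +oo ->
    Q.-integrable setT (fun w => nu (box w)).
  move=> sf fin_nu; apply/integrableP; split; first exact: measurable_open_box_subvector.
  by under eq_integral do rewrite gee0_abs//.
have intp := integrable_box _ sfp finp.
have intn := integrable_box _ sfn finn.
exists (fun w => radon_pos mu (box w) - radon_neg mu (box w)); split.
- exact: integrableB.
- by rewrite integralB// !integral_joint_tail.
have := integrable_ae measurableT intp; have := integrable_ae measurableT intn.
apply: filterS2 => w /(_ I) fn /(_ I) fp.
have subE : subvector X d w = restrict_face d (\row_k X k w).
  by apply/rowP => i; rewrite !mxE.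
case: (pselect (forall i, 0 < subvector X d w 0 i)%R) => [X0|/existsNP[i /negP Xi]].
  rewrite -[in LHS](fineK fp) -[in LHS](fineK fn) -EFinB; congr _%:E.
  rewrite /face_increment -subE.
  apply: (mixed_derivative_open_box hmu) => //.
  - have cface := @continuous_face R n (~: d)%SET d.
    move=> y; apply: (@continuous_comp _ _ _ _ (h \o @clamp R n) y (cface y)).
    exact: continuous_comp_clamp.
  - move=> y y0; rewrite clamp_id// => k; rewrite mxE; case: ifP => // _.
    exact: sumr_ge0.
  - by rewrite ltey_eq fp.
  - by rewrite ltey_eq fn.
rewrite -leNgt in Xi.
have box0 : box w = set0.
  apply/seteqP; split=> // y /(_ i) /andP[y0 yX].
  by have := lt_trans y0 yX; rewrite ltNge Xi.
rewrite box0 !measure0 sube0 (@face_increment_eq0 _ _ _ _ _ (enum_val i))//.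
  exact: enum_valP.
by move: Xi; rewrite !mxE.
Qed.

End Pricing.

Theorem theorem3p2 (R : realType) (disp : measure_display)
  (Omega : measurableType disp) (Q : probability Omega R)
  (n : nat) (n_gt0 : (0 < n)%N)
  (T : R) (T_gt0 : 0 < T)
  (B : R -> R) (B0 : B 0 = 1)
  (B_ndecr : {in `[0, T] &, {homo B : s t / s <= t}})
  (X : 'I_n -> {RV Q >-> R})
  (X_L1 : forall k, Q.-integrable [set: Omega] (EFin \o X k))
  (X_ge0 : forall k, {ae Q, forall w, 0 <= X k w})
  (h : 'rV[R]_n -> R)
  (h_cont : {within @nonneg_orthant R n, continuous h})
  (h_fin : forall z d : {set 'I_n}, complementary z d ->
     (absA X h z d < +oo)%E) :
  price B T X h =
  (((B T)^-1)%:E *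
   \sum_(zd : {set 'I_n} * {set 'I_n} | complementary zd.1 zd.2)
     valA X h zd.1 zd.2)%E.
Proof.
rewrite /price; congr (_ * _)%E.
have fin_d d : (absA X h (~: d)%SET d < +oo)%E.
  by apply: h_fin; rewrite complementaryE.
have [Y HY] := choice (fun d => valA_integral h_cont (fin_d d)).
have -> : (\sum_(zd : {set 'I_n} * {set 'I_n} | complementary zd.1 zd.2)
    valA X h zd.1 zd.2 = \sum_(d : {set 'I_n}) \int[Q]_w Y d w)%E.
  rewrite (reindex_onto (fun d => ((~: d)%SET, d)) snd)/=; last first.
    by move=> [z d]; rewrite /= complementaryE// => /eqP ->.
  apply: eq_big => [d|d _]; first by rewrite complementaryE// !eqxx.
  by have [_ -> _] := HY d.
rewrite -integral_sum//; last by move=> d; have [] := HY d.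
rewrite expectation.unlock; apply: integral_ae_eq.
(* There are finitely many faces, so a single null set serves them all. *)
have aeY : {ae Q, forall w, forall d, Y d w = (face_increment h d (\row_k X k w))%:E}.
  by apply: filter_forall => d; have [] := HY d.
have aeX : {ae Q, forall w, forall k, 0 <= X k w}.
  by apply: filter_forall => k; exact: X_ge0.
apply: filterS2 aeY aeX => w Yw Xw /=.
under eq_bigr do rewrite Yw.
(* Nonnegativity of the prices enters here: [clamp] fixes the price vector, so the increments add up
   to [h] itself. *)
rewrite sumEFin sum_face_increment clamp_id// => k.
by rewrite mxE.
Qed.
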